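(* Let $\xi$ be an invariant random measure on $G$ and let $\mathbb{Q}$ be a $\sigma$-finite measure on $(\Omega,\mathcal{F})$. There exists a $\sigma$-finite stationary measure $\mathbb{P}$ on $(\Omega,\mathcal{F})$ such that $\mathbb{Q}=\mathbb{P}_\xi$ if and only if $\mathbb{Q}$ is mass-stationary for $\xi$.
   Context: $G$ is a locally compact, second countable Hausdorff topological Abelian group with neutral element $0$, Borel $\sigma$-field $\mathcal{G}$ and fixed Haar measure $\lambda$. $\mathbf{M}$ is the set of locally finite measures on $G$ (finite on compact sets), with the $\sigma$-field generated by the maps $\mu\mapsto\mu(B)$, $B\in\mathcal{G}$. $(\Omega,\mathcal{F})$ is a measurable space equipped with a measurable flow $\theta_s:\Omega\to\Omega$, $s\in G$: $(\omega,s)\mapsto\theta_s\omega$ is measurable, $\theta_0$ is the identity, and $\theta_s\circ\theta_t=\theta_{s+t}$ for all $s,t\in G$. A measure $\mathbb{P}$ on $(\Omega,\mathcal{F})$ is stationary if it is invariant under every $\theta_s$, $s\in G$. A random measure on $G$ is a measurable map $\xi:\Omega\to\mathbf{M}$, written $\xi(\omega,B):=\xi(\omega)(B)$; it is invariant if $\xi(\theta_s\omega,B-s)=\xi(\omega,B)$ for all $\omega\in\Omega$, $s\in G$, $B\in\mathcal{G}$. For $\sigma$-finite stationary $\mathbb{P}$ and an invariant random measure $\xi$, the Palm measure $\mathbb{P}_\xi$ of $\xi$ (with respect to $\mathbb{P}$) is the ($\sigma$-finite) measure on $(\Omega,\mathcal{F})$ given by $$\mathbb{P}_\xi(A):=\lambda(B)^{-1}\iint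 \mathbf{1}_A(\theta_s\omega)\mathbf{1}_B(s)\,\xi(\omega,ds)\,\mathbb{P}(d\omega),\qquad A\in\mathcal{F},$$ for any $B\in\mathcal{G}$ with $0<\lambda(B)<\infty$ (the definition does not depend on $B$). For relatively compact $C\in\mathcal{G}$ put, suppressing $\omega$, $$T_C(t,B):=\xi(C+t)^{-1}\,\xi(B\cap(C+t)),\qquad t\in G,\ B\in\mathcal{G},$$ if $\xi(C+t)>0$, and let $T_C(t,\cdot)$ equal some fixed probability measure otherwise. If $0<\lambda(C)<\infty$, let $\lambda_C(B):=\lambda(B\cap C)/\lambda(C)$ be the uniform distribution on $C$. $\partial C$ denotes the boundary of $C$, and $\mathbb{E}_{\mathbb{Q}}$ denotes integration with respect to $\mathbb{Q}$. A $\sigma$-finite measure $\mathbb{Q}$ on $(\Omega,\mathcal{F})$ is called mass-stationary for $\xi$ if $\mathbb{Q}(\xi(G)=0)=0$ and $$\mathbb{E}_{\mathbb{Q}}\left[\iint \mathbf{1}_A(\theta_s,s+r)\,T_C(-r,ds)\,\lambda_C(dr)\right]=\mathbb{Q}\otimes\lambda_C(A),\qquad A\in\mathcal{F}\otimes\mathcal{G},$$ holds for all relatively compact sets $C\in\mathcal{G}$ with $\lambda(C)>0$ and $\lambda(\partial C)=0$. (Here $\mathbf{1}_A(\theta_s,s+r)$ stands for $\omega\mapsto\mathbf{1}_A(\theta_s\omega,s+r)$.) *)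

(* Defs.v *)
From HB Require Import structures.
From mathcomp Require Import all_boot all_order all_algebra.
From mathcomp Require Import all_classical all_reals all_analysis.
From mathcomp Require Import measurable_realfun.

Set Implicit Arguments.
Unset Strict Implicit.
Unset Printing Implicit Defensive.
Import Order.TTheory GRing.Theory Num.Theory.

Local Open Scope classical_set_scope.
Local Open Scope ring_scope.
Local Open Scope ereal_scope.

(* The group G equipped with its Borel sigma-field. An alias is used since the
   library has no structure joining topological groups and measurable spaces;
   the point required by [measurableType] is 0. *)
Definition borel (G : topologicalZmodType) : Type := G.

Section borel_instances.
Variable G : topologicalZmodType.

HB.instance Definition _ := TopologicalZmodule.on (borel G).
HB.instance Definition _ := isPointed.Build (borel G) (0%R : G).
HB.instance Definition _ := @isMeasurable.Build
  (sigma_display (@open (borel G))) (borel G) <<s @open (borel G) >>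
  (@sigma_algebra0 _ setT (@open (borel G)))
  (@sigma_algebraC _ (@open (borel G)))
  (@sigma_algebra_bigcup _ setT (@open (borel G))).

End borel_instances.

Section translation.
Context (G : topologicalZmodType).

(* [translate B t] is B + t; in particular B - s is [translate B (- s)]. *)
Definition translate (B : set (borel G)) (t : borel G) : set (borel G) :=
  [set (x + t)%R | x in B].

Lemma translateE B t : translate B t = (fun x => x - t)%R @^-1` B.
Proof.
apply/seteqP; split => [_ [x Bx <-]|x Bx] /=; first by rewrite addrK.
by exists (x - t)%R => //; rewrite subrK.
Qed.

Lemma measurable_translate B t : measurable B -> measurable (translate B t).
Proof.
move=> mB; rewrite translateE -[X in measurable X]setTI.
have mf : measurable_fun [set: borel G] (fun x : borel G => x - t)%R.
  apply: (@measurability _ _ (borel G) (borel G) setT _ (@open (borel G))) => //.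
  move=> _ [U oU <-].
  rewrite setTI; apply: sub_gen_smallest.
  apply: open_comp => // x _.
  apply: (@continuous_comp _ _ _ (fun x : borel G => (x, t))
    (fun p : borel G * borel G => p.1 - p.2)%R); last exact: sub_continuous.
  by apply: cvg_pair; [exact: cvg_id|exact: cvg_cst].
exact: mf.
Qed.

Definition boundary (C : set (borel G)) : set (borel G) := closure C `\` C^°.

End translation.

Section locally_finite_measures.
Context (G : topologicalZmodType) (R : realType).

Definition locally_finite (mu : set (borel G) -> \bar R) :=
  forall K, compact K -> mu K < +oo.

Record lfmeasure := LFMeasure {
  lfmeasure_val :> {measure set (borel G) -> \bar R} ;
  lfmeasure_finite : locally_finite lfmeasure_val }.

HB.instance Definition _ := gen_eqMixin lfmeasure.
HB.instance Definition _ := gen_choiceMixin lfmeasure.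

Lemma locally_finite_mzero : locally_finite (@mzero _ (borel G) R).
Proof. by move=> K _; exact: ltry. Qed.

HB.instance Definition _ :=
  isPointed.Build lfmeasure (LFMeasure locally_finite_mzero).

(* The sigma-field generated by the evaluations mu |-> mu B, B measurable. *)
Definition lfmeasure_gen : set (set lfmeasure) :=
  \bigcup_(B in @measurable _ (borel G))
    preimage_set_system [set: lfmeasure] (fun mu => mu B) measurable.

HB.instance Definition _ := @isMeasurable.Build (sigma_display lfmeasure_gen)
  lfmeasure <<s lfmeasure_gen >> (@sigma_algebra0 _ setT lfmeasure_gen)
  (@sigma_algebraC _ lfmeasure_gen) (@sigma_algebra_bigcup _ setT lfmeasure_gen).

End locally_finite_measures.

Arguments lfmeasure G R.

Section mass_stationarity.
Context (G : topologicalZmodType) (R : realType).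
Context d (Omega : measurableType d).

(* On a locally compact second countable Hausdorff group every locally finite
   Borel measure is regular, so regularity need not be required. *)
Record haar_measure (lambda : {measure set (borel G) -> \bar R}) : Prop := {
  haar_locally_finite : locally_finite lambda ;
  haar_invariant : forall B t, measurable B ->
    lambda (translate B t) = lambda B ;
  haar_neq0 : lambda [set: borel G] != 0 }.

Record measurable_flow (theta : borel G -> Omega -> Omega) : Prop := {
  flow_measurable :
    measurable_fun [set: Omega * borel G] (fun p => theta p.2 p.1) ;
  flow0 : forall w, theta 0%R w = w ;
  flowD : forall s t w, theta s (theta t w) = theta (s + t)%R w }.

Definition stationary (theta : borel G -> Omega -> Omega)
    (P : {measure set Omega -> \bar R}) :=
  forall s A, measurable A -> P (theta s @^-1` A) = P A.

Definition random_measure (xi : Omega -> lfmeasure G R) :=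
  measurable_fun [set: Omega] xi.

Definition flow_invariant (theta : borel G -> Omega -> Omega)
    (xi : Omega -> lfmeasure G R) :=
  forall w s B, measurable B -> xi (theta s w) (translate B (- s)%R) = xi w B.

Definition palm_formula (lambda : {measure set (borel G) -> \bar R})
    (theta : borel G -> Omega -> Omega) (xi : Omega -> lfmeasure G R)
    (P : {measure set Omega -> \bar R}) (B : set (borel G))
    (A : set Omega) : \bar R :=
  (lambda B)^-1 *
  \int[P]_w \int[xi w]_s ((\1_A (theta s w))%:E * (\1_B s)%:E).

(* Q = P_xi. For stationary P and invariant xi the formula does not depend on
   the choice of B. *)
Definition is_palm (lambda : {measure set (borel G) -> \bar R})
    (theta : borel G -> Omega -> Omega) (xi : Omega -> lfmeasure G R)
    (P Q : {measure set Omega -> \bar R}) :=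
  forall B, measurable B -> 0 < lambda B < +oo ->
  forall A, measurable A -> Q A = palm_formula lambda theta xi P B A.

(* [mnormalize m nu] is m / m(G) if 0 < m(G) < +oo, and nu otherwise. For
   relatively compact C the value xi(C + t) is finite, so that nu is used
   exactly when xi(C + t) = 0. *)
Definition T_kernel (xi : Omega -> lfmeasure G R) (nu : probability (borel G) R)
    (C : set (borel G)) (mC : measurable C) (w : Omega) (t : borel G) :
    probability (borel G) R :=
  mnormalize (mrestr (xi w) (measurable_translate t mC)) nu.

(* The second argument of [mnormalize] is irrelevant if 0 < lambda C < +oo. *)
Definition uniform_on (lambda : {measure set (borel G) -> \bar R})
    (C : set (borel G)) (mC : measurable C) : probability (borel G) R :=
  mnormalize (mrestr lambda mC) (dirac (0%R : borel G)).

Definition mass_stationary (lambda : {measure set (borel G) -> \bar R})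
    (theta : borel G -> Omega -> Omega) (xi : Omega -> lfmeasure G R)
    (nu : probability (borel G) R) (Q : {measure set Omega -> \bar R}) :=
  Q [set w | xi w [set: borel G] = 0] = 0 /\
  forall (C : set (borel G)) (mC : measurable C),
    precompact C -> 0 < lambda C -> lambda (boundary C) = 0 ->
  forall A : set (Omega * borel G), measurable A ->
    \int[Q]_w \int[uniform_on lambda mC]_r \int[T_kernel xi nu mC w (- r)%R]_s
      (\1_A (theta s w, (s + r)%R))%:E
    = (Q \x uniform_on lambda mC) A.

End mass_stationarity.

(* Main.v *)
Require Import Defs.
From HB Require Import structures.
From mathcomp Require Import all_boot all_order all_algebra.
From mathcomp Require Import all_classical all_reals all_analysis.
From mathcomp Require Import measurable_realfun finmap.

Set Implicit Arguments.
Unset Strict Implicit.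
Unset Printing Implicit Defensive.
Import Order.TTheory GRing.Theory Num.Theory.
Import numFieldNormedType.Exports.

Local Open Scope classical_set_scope.
Local Open Scope ring_scope.
Local Open Scope ereal_scope.

(** The idea is to change variables so that the shifts by the flow disappear
    from both notions. Let Lam be the image of Q x lambda under the map
    (w, s) |-> (theta_(-s) w, s) on Omega x G ([palm_campbell Q]).

    - The Palm formula says that Q = P_xi if and only if Lam is the Campbell
      measure P(dw) xi(w, ds) of P ([campbell P]): see [palm_disintegration]
      and [disintegration_is_palm].

    - Invariance of xi turns the kernel T_C(- r, .) at w into the law
      xi(w', . /\ C) / xi(w', C) at w' = theta_(-r) w. The equation of
      mass-stationarity for C therefore says that Lam, restricted to Omega x C,
      does not change when the mark s is replaced by a random point with the
      law xi(w, . /\ C) / xi(w, C) ([mass_formulaP]). In other words, on the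
      event xi(w, C) > 0 this law is the conditional law of s given w.

    A measure of the form P(dw) xi(w, ds) obviously has the second property
    ([resample_campbell]), and it does not charge the event xi(G) = 0; this
    proves that Palm measures are mass-stationary.

    Conversely, let Q be mass-stationary and let C_n increase to G. Weighting
    Lam on Omega x C_n by 1 / xi(w, C_n) and forgetting the mark gives a measure
    P_n such that P_n(dw) xi(w, ds) coincides with Lam on the set of all (w, s)
    with xi(w, C_n) > 0 and s in C_n ([campbell_local]). A measure on the event
    xi(C_n) > 0 can be read off its Campbell measure ([campbell_inversion]), so
    that P_n and P_m coincide on that event if n <= m
    ([local_inverse_consistent]). The P_n are thus restrictions of one measure
    P on the event xi(G) > 0, whose Campbell measure is Lam
    ([campbell_glued_inverse]). By translation invariance of lambda, Lam is
    invariant under (w, s) |-> (theta_t w, s - t); hence P and its image under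
    theta_t have the same Campbell measure and must be equal
    ([campbell_inj]). Sigma-finiteness of P follows from that of Lam by Markov's
    inequality ([palm_sigma_finite]).

    Mass-stationarity speaks only of sets C with a lambda-null boundary. An
    exhaustion of G by such sets ([haar_exhaustion]) is built from sublevel sets
    of Urysohn functions, almost all of whose level sets are null by Fubini's
    theorem ([null_level_set]). *)

(** * Nonnegative measurable functions, densities and image measures *)

Section ge0_measurable_ind.
Context d (T : measurableType d) (R : realType).
Import HBNNSimple.

(** Two functionals that are additive, positively homogeneous and continuous
    along increasing sequences agree if they agree on indicators; this principle
    also carries measurability of parameter integrals along. *)
Lemma ge0_measurable_ind (H : (T -> \bar R) -> Prop) :
  (forall A, measurable A -> H (fun x => (\1_A x)%:E)) ->
  (forall (c : R) f, (0 <= c)%R -> (forall x, 0 <= f x) ->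
     measurable_fun setT f -> H f -> H (fun x => c%:E * f x)) ->
  (forall f g, (forall x, 0 <= f x) -> measurable_fun setT f ->
     (forall x, 0 <= g x) -> measurable_fun setT g ->
     H f -> H g -> H (fun x => f x + g x)) ->
  (forall f_ : (T -> \bar R)^nat, (forall n x, 0 <= f_ n x) ->
     (forall n, measurable_fun setT (f_ n)) ->
     (forall x, nondecreasing_seq (f_ ^~ x)) ->
     (forall n, H (f_ n)) -> H (fun x => limn (f_ ^~ x))) ->
  forall f, (forall x, 0 <= f x) -> measurable_fun setT f -> H f.
Proof.
move=> Hindic Hscale Hadd Hlim f f0 mf.
pose f_ := nnsfun_approx measurableT mf.
have -> : f = fun x => limn (fun n => (f_ n x)%:E).
  by apply/funext => x; apply/esym/cvg_lim => //; exact: cvg_nnsfun_approx.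
apply: Hlim => [n x|n|x m n mn|n].
- by rewrite lee_fin.
- exact/measurable_EFinP.
- by rewrite lee_fin; exact/lefP/nd_nnsfun_approx.
have -> : (fun x => (f_ n x)%:E) = fun x => \sum_(r <- fset_set (range (f_ n)))
    (fun r x => `|r|%:E * (\1_(f_ n @^-1` [set r]) x)%:E) r x.
  apply/funext => x; rewrite fimfunE -fsumEFin// fsbig_finite//=.
  apply: eq_big_seq => r; rewrite in_fset_set// => /set_mem[y _ <-].
  by rewrite EFinM ger0_norm.
elim: (finmap.enum_fset _) => [|r s IH].
  under eq_fun do rewrite big_nil.
  have /funext -> : (fun=> 0) =1 fun x : T => (\1_(@set0 T) x)%:E :> \bar R.
    by move=> x; rewrite indic0.
  exact: Hindic.
under eq_fun do rewrite big_cons.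
have mind q : measurable_fun setT (fun x => (\1_(f_ n @^-1` [set q]) x)%:E : \bar R).
  exact/measurable_EFinP.
apply: Hadd => //.
- exact: measurable_funeM.
- by move=> x; apply: sume_ge0 => q _ /=; rewrite mule_ge0// lee_fin.
- by apply: emeasurable_sum => q; exact: measurable_funeM.
by apply: Hscale => //; exact: Hindic.
Qed.

End ge0_measurable_ind.

Section density.
Context d (T : measurableType d) (R : realType).
Variables (mu : {measure set T -> \bar R}) (g : T -> R).

(** The density is real-valued because multiplication by a finite number is
    compatible with limits in the extended reals, and multiplication by +oo is
    not. *)
Definition density of (forall x, 0 <= g x)%R & measurable_fun setT g :=
  fun A => \int[mu]_(x in A) (g x)%:E.

Hypotheses (g0 : forall x, (0 <= g x)%R) (mg : measurable_fun setT g).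

Let mEg : measurable_fun setT (EFin \o g).
Proof. exact/measurable_EFinP. Qed.

Let density0 : density g0 mg set0 = 0.
Proof. exact: integral_set0. Qed.

Let density_ge0 A : 0 <= density g0 mg A.
Proof. by apply: integral_ge0 => x _; rewrite lee_fin. Qed.

Let density_sigma_additive : semi_sigma_additive (density g0 mg).
Proof.
move=> F mF tF mUF; rewrite /density ge0_integral_bigcup//; last 2 first.
- exact: measurable_funTS.
- by move=> x _; rewrite lee_fin.
apply: is_cvg_nneseries => n _ _.
by apply: integral_ge0 => x _; rewrite lee_fin.
Qed.

HB.instance Definition _ := isMeasure.Build _ _ _ (density g0 mg)
  density0 density_ge0 density_sigma_additive.

Lemma ge0_integral_density f : (forall x, 0 <= f x) -> measurable_fun setT f ->
  \int[density g0 mg]_x f x = \int[mu]_x ((g x)%:E * f x).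
Proof.
have gf0 h x : 0 <= h x -> 0 <= (g x)%:E * h x.
  by move=> h0; rewrite mule_ge0// lee_fin.
have mgf (h : T -> \bar R) : measurable_fun setT h ->
  measurable_fun setT (fun x => (g x)%:E * h x) by exact: emeasurable_funM.
move: f; apply: ge0_measurable_ind => [A mA|c f c0 f0 mf E|f h f0 mf h0 mh Ef Eh|
    f_ f_0 mf_ nd E].
- rewrite integral_indic// setIT /= /density integral_mkcond.
  by apply: eq_integral => x _; rewrite epatch_indic.
- rewrite ge0_integralZl// E -ge0_integralZl//; [|exact: mgf|by move=> x _; exact: gf0].
  by apply: eq_integral => x _; rewrite muleCA.
- rewrite ge0_integralD// Ef Eh -ge0_integralD//.
  + by apply: eq_integral => x _; rewrite ge0_muleDr.
  + by move=> x _; exact: gf0.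
  + exact: mgf.
  + by move=> x _; exact: gf0.
  + exact: mgf.
- rewrite monotone_convergence//.
  under eq_fun do rewrite E.
  rewrite -monotone_convergence//.
  + apply: eq_integral => x _; apply/cvg_lim => //.
    by apply: cvgeZl => //; exact: ereal_nondecreasing_is_cvgn.
  + by move=> n; exact: mgf.
  + by move=> n x _; exact: gf0.
  + by move=> x _ m n mn; rewrite lee_wpmul2l ?lee_fin//; exact: nd.
Qed.

End density.

Section image_measure.
Context d d' (T1 : measurableType d) (T2 : measurableType d') (R : realType).
Variables (f : T1 -> T2) (mf : measurable_fun setT f).
Variable mu : {measure set T1 -> \bar R}.

(** The proof of measurability is an argument, so that the structure of a
    measure can be inferred from the term. *)
Definition image_measure : {measure set T2 -> \bar R}.
Proof. by refine (pushforward mu f : {measure set T2 -> \bar R}). Defined.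

Lemma ge0_integral_image_measure h : (forall y, 0 <= h y) ->
  measurable_fun setT h ->
  \int[image_measure]_y h y = \int[mu]_x h (f x).
Proof.
by move=> h0 mh; rewrite (ge0_integral_pushforward mf mu).
Qed.

End image_measure.

Lemma measurable_EFin_indic d (T : measurableType d) (R : realType)
    (A : set T) :
  measurable A -> measurable_fun setT (fun x => (\1_A x)%:E : \bar R).
Proof. by move=> mA; apply/measurable_EFinP. Qed.

(** * Measures on a product defined by a kernel *)

Section semidirect.
Context d d' (X : measurableType d) (Y : measurableType d') (R : realType).

(** What is needed of a kernel for the measure mu(dx) k(x, dy) to exist. *)
Definition xsection_measurable (k : X -> {measure set Y -> \bar R}) :=
  forall A, measurable A -> measurable_fun setT (fun x => k x (xsection A x)).

Variables (mu : {measure set X -> \bar R}) (k : X -> {measure set Y -> \bar R}).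

(** The measure mu(dx) k(x, dy) on the product. *)
Definition semidirect of xsection_measurable k :=
  fun A => \int[mu]_x k x (xsection A x).

Hypothesis mk : xsection_measurable k.

Let semidirect0 : semidirect mk set0 = 0.
Proof. by rewrite /semidirect integral0_eq// => x _; rewrite xsection0 measure0. Qed.

Let semidirect_ge0 A : 0 <= semidirect mk A.
Proof. exact: integral_ge0. Qed.

Let semidirect_sigma_additive : semi_sigma_additive (semidirect mk).
Proof.
move=> F mF tF mUF.
rewrite [X in _ --> X](_ : _ = \sum_(n <oo) (semidirect mk) (F n)); last first.
  rewrite -integral_nneseries//; last by move=> n; exact: mk.
  apply: eq_integral => x _; apply/esym/cvg_lim => //=; rewrite xsection_bigcup.
  apply: (measure_sigma_additive _ (trivIset_xsection tF)) => ?.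
  exact: measurable_xsection.
by apply: is_cvg_nneseries => n _ _; exact: integral_ge0.
Qed.

HB.instance Definition _ := isMeasure.Build _ _ _ (semidirect mk)
  semidirect0 semidirect_ge0 semidirect_sigma_additive.

(** The two claims are proved together: additivity and monotone convergence
    under the outer integral require measurability of the inner one. *)
Lemma semidirect_ind (f : X * Y -> \bar R) : (forall z, 0 <= f z) ->
  measurable_fun setT f ->
  measurable_fun setT (fun x => \int[k x]_y f (x, y)) /\
  \int[semidirect mk]_z f z = \int[mu]_x \int[k x]_y f (x, y).
Proof.
have msec (h : X * Y -> \bar R) x :
    measurable_fun setT h -> measurable_fun setT (fun y => h (x, y)).
  by move=> mh; exact: (measurableT_comp mh (pair1_measurable x)).
move: f; apply: ge0_measurable_ind => [A mA|c f c0 f0 mf [mE E]|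
    f h f0 mf h0 mh [mEf Ef] [mEh Eh]|f_ f_0 mf_ nd E].
- have -> : (fun x => \int[k x]_y (\1_A (x, y))%:E) = fun x => k x (xsection A x).
    apply/funext => x; rewrite -[xsection A x]setIT -integral_indic//; last first.
      exact: measurable_xsection.
    by apply: eq_integral => y _; rewrite !indicE mem_xsection.
  by split; [exact: mk|rewrite integral_indic// setIT].
- have -> : (fun x => \int[k x]_y (c%:E * f (x, y))) =
      fun x => c%:E * \int[k x]_y f (x, y).
    by apply/funext => x; rewrite ge0_integralZl//; exact: msec.
  split; first exact: measurable_funeM.
  rewrite ge0_integralZl//; last by move=> x _; exact: integral_ge0.
  by rewrite ge0_integralZl// E.
- have -> : (fun x => \int[k x]_y (f (x, y) + h (x, y))) =
      fun x => \int[k x]_y f (x, y) + \int[k x]_y h (x, y).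
    by apply/funext => x; rewrite ge0_integralD//; exact: msec.
  split; first exact: emeasurable_funD.
  rewrite [RHS]ge0_integralD//; [|by move=> x _; exact: integral_ge0..].
  by rewrite ge0_integralD// Ef Eh.
- have ndI x : nondecreasing_seq (fun n => \int[k x]_y f_ n (x, y)).
    move=> m n mn; apply: ge0_le_integral => //; [exact: msec|exact: msec|].
    by move=> y _; exact: nd.
  have -> : (fun x => \int[k x]_y limn (f_ ^~ (x, y))) =
      fun x => limn (fun n => \int[k x]_y f_ n (x, y)).
    apply/funext => x; rewrite monotone_convergence//.
    by move=> n; exact: msec.
  split.
    apply: (emeasurable_fun_cvg (fun n x => \int[k x]_y f_ n (x, y))) => [n|x _].
      by have [] := E n.
    exact: ereal_nondecreasing_is_cvgn.
  rewrite monotone_convergence//.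
  rewrite monotone_convergence//.
  + by congr (limn _); apply/funext => n; have [_ ->] := E n.
  + by move=> n; have [] := E n.
  + by move=> n x _; exact: integral_ge0.
Qed.

Lemma ge0_integral_semidirect f : (forall z, 0 <= f z) ->
  measurable_fun setT f ->
  \int[semidirect mk]_z f z = \int[mu]_x \int[k x]_y f (x, y).
Proof. by move=> f0 mf; have [] := semidirect_ind f0 mf. Qed.

End semidirect.

Lemma measurable_integral_xsection d d' (X : measurableType d)
    (Y : measurableType d') (R : realType) (k : X -> {measure set Y -> \bar R}) f :
  xsection_measurable k -> (forall z, 0 <= f z) -> measurable_fun setT f ->
  measurable_fun setT (fun x => \int[k x]_y f (x, y)).
Proof. by move=> mk f0 mf; have [] := semidirect_ind mzero mk f0 mf. Qed.

Section locally_finite_kernel.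
Context d d' (X : measurableType d) (Y : measurableType d') (R : realType).

(** Finiteness of each k x (C n) suffices, without a bound that is uniform in x:
    the monotone class argument on C n only subtracts measures of sections, one
    x at a time. *)
Lemma xsection_measurable_locally_finite (k : X -> {measure set Y -> \bar R})
    (C : (set Y)^nat) :
  (forall B, measurable B -> measurable_fun setT (k ^~ B)) ->
  (forall n, measurable (C n)) -> nondecreasing_seq C ->
  \bigcup_n C n = setT -> (forall n x, k x (C n) < +oo) ->
  xsection_measurable k.
Proof.
move=> mk mC ndC CT kC A mA.
pose mixin := isKernel.Build _ _ X Y R k mk.
pose k' : R.-ker X ~> Y := HB.pack k mixin.
apply: (emeasurable_fun_cvg (fun n x => mrestr (k x) (mC n) (xsection A x))).
  move=> n; apply: (@measurable_prod_subset_xsection_kernel _ _ _ _ _ k' _ (mC n) _ _ mA).2.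
  move=> x; exists (fine (k x (C n)) + 1)%R => B mB.
  rewrite EFinD fineK ?ge0_fin_numE//.
  rewrite (@le_lt_trans _ _ (k x (C n)))//.
    apply: (@le_measure _ _ _ (k x)) => //; apply: mem_set => //; exact: measurableI.
  by rewrite lteDl// ge0_fin_numE.
move=> x _; rewrite /mrestr.
have {2}-> : xsection A x = \bigcup_n (xsection A x `&` C n).
  by rewrite -setI_bigcupr CT setIT.
apply: nondecreasing_cvg_mu.
- by move=> n; apply: measurableI => //; exact: measurable_xsection.
- by apply: bigcup_measurable => n _; apply: measurableI => //; exact: measurable_xsection.
- by move=> m n mn; apply/subsetPset; apply: setIS; exact/subsetPset/ndC.
Qed.

End locally_finite_kernel.

(** * Normalized restrictions and comparison of measures *)

Lemma measurable_invr (R : realType) : measurable_fun setT (GRing.inv : R -> R).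
Proof.
have -> : GRing.inv = fun x : R => if x == 0%R then 0%R else x^-1%R.
  by apply/funext => x; case: eqP => // ->; rewrite invr0.
apply: measurable_fun_if => //; first exact: measurable_fun_eqr.
rewrite setTI (_ : _ @^-1` _ = [set x | x != 0%R]); last first.
  by apply/seteqP; split => x /= => [->|/negbTE].
apply: open_continuous_measurable_fun; first exact: open_neq.
by move=> x /set_mem/=; exact: inv_continuous.
Qed.

Lemma ge0_integral_mnormalize_mrestr d (T : measurableType d) (R : realType)
    (mu : {measure set T -> \bar R}) (C : set T) (mC : measurable C)
    (P : probability T R) (h : T -> \bar R) :
  mu C != 0 -> mu C < +oo -> (forall x, 0 <= h x) -> measurable_fun setT h ->
  \int[mnormalize (mrestr mu mC) P]_x h x =
  \int[mu]_x (((fine (mu C))^-1 * \1_C x)%:E * h x).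
Proof.
move=> C0 Coo h0 mh.
have g0 x : (0 <= (fine (mu C))^-1 * \1_C x)%R by rewrite mulr_ge0// invr_ge0 fine_ge0.
have mg : measurable_fun setT (fun x => (fine (mu C))^-1 * \1_C x)%R.
  exact: measurable_funM.
rewrite -(ge0_integral_density mu g0 mg)//.
apply: eq_measure_integral => A mA _; rewrite /= /density /mnormalize/= /mrestr setTI.
rewrite (negbTE C0) (lt_eqF Coo)/=.
under eq_integral do rewrite EFinM.
rewrite ge0_integralZl//; last exact/measurable_EFinP.
by rewrite integral_indic// muleC setIC.
Qed.

Lemma integral_mnormalize_mrestr0 d (T : measurableType d) (R : realType)
    (mu : {measure set T -> \bar R}) (C : set T) (mC : measurable C)
    (P : probability T R) (h : T -> \bar R) : mu C = 0 ->
  \int[mnormalize (mrestr mu mC) P]_x h x = \int[P]_x h x.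
Proof.
move=> C0; apply: eq_measure_integral => A mA _.
by rewrite /= /mnormalize/= /mrestr setTI C0 eqxx.
Qed.

(** Continuity from below on both sides. *)
Lemma eq_measure_bigcup d (T : measurableType d) (R : realType)
    (m1 m2 : {measure set T -> \bar R}) (D : (set T)^nat) (B : set T) :
  (forall n, measurable (D n)) -> nondecreasing_seq D -> measurable B ->
  (forall n, m1 (B `&` D n) = m2 (B `&` D n)) ->
  m1 (B `&` \bigcup_n D n) = m2 (B `&` \bigcup_n D n).
Proof.
move=> mD ndD mB m12; rewrite setI_bigcupr.
have cvgD (m : {measure set T -> \bar R}) :
    m (B `&` D n) @[n --> \oo] --> m (\bigcup_n (B `&` D n)).
  apply: nondecreasing_cvg_mu.
  - by move=> n; exact: measurableI.
  - by apply: bigcup_measurable => n _; exact: measurableI.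
  - by move=> i j ij; apply/subsetPset; apply: setIS; exact/subsetPset/ndD.
have c1 := cvgD m1; rewrite (funext m12) in c1.
exact: cvg_unique c1 (cvgD m2).
Qed.

(** Otherwise mu and the zero measure agree on every D n. *)
Lemma neq0_exhaustion d (T : measurableType d) (R : realType)
    (mu : {measure set T -> \bar R}) (D : (set T)^nat) :
  (forall n, measurable (D n)) -> nondecreasing_seq D ->
  \bigcup_n D n = setT -> mu setT != 0 -> exists n, mu (D n) != 0.
Proof.
move=> mD ndD DT muT; apply: contrapT => nD.
have /negP := muT; apply; apply/eqP.
have := @eq_measure_bigcup _ _ R mu mzero D setT.
rewrite DT !setTI => -> // n; rewrite setTI; apply/eqP.
by apply: contra_notT nD => Dn; exists n.
Qed.

Lemma ge0_integral_indic_null d (T : measurableType d) (R : realType)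
    (mu : {measure set T -> \bar R}) (C : set T) (g : T -> \bar R) :
  measurable C -> mu C = 0 -> (forall x, 0 <= g x) -> measurable_fun setT g ->
  \int[mu]_x ((\1_C x)%:E * g x) = 0.
Proof.
move=> mC C0 g0 mg.
rewrite -[RHS](@integral_abs_eq0 _ _ _ mu C g)//; last exact: measurable_funTS.
rewrite [RHS]integral_mkcond; apply: eq_integral => x _.
by rewrite patchE indicE; case: ifPn => _; rewrite ?mul1e ?mul0e// gee0_abs.
Qed.

Lemma eq_measure_conull d (T : measurableType d) (R : realType)
    (m1 m2 : {measure set T -> \bar R}) (D B : set T) :
  measurable D -> measurable B -> m1 (~` D) = 0 -> m2 (~` D) = 0 ->
  m1 (B `&` D) = m2 (B `&` D) -> m1 B = m2 B.
Proof.
move=> mD mB D1 D2 DB.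
have null (m : {measure set T -> \bar R}) : m (~` D) = 0 -> m B = m (B `&` D).
  move=> mD0.
  have BD0 : m (B `\` D) = 0.
    apply: (subset_measure0 _ _ _ mD0); [exact: measurableD|exact: measurableC|].
    by move=> x [].
  have mU : m ((B `&` D) `|` (B `\` D)) = m (B `&` D) + m (B `\` D).
    apply: measureU; [exact: measurableI|exact: measurableD|].
    by rewrite setDE setIACA setICr setI0.
  by rewrite -{1}(setUIDK B D) mU BD0 adde0.
by rewrite (null m1 D1) DB -(null m2 D2).
Qed.

Section as_sigma_finite.
Context d (T : measurableType d) (R : realType) (mu : {measure set T -> \bar R}).

(** A copy of mu from which the proof of sigma-finiteness can be inferred. *)
Definition as_sigma_finite of sigma_finite setT mu : set T -> \bar R := mu.

Hypothesis mu_sigma_finite : sigma_finite setT mu.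

HB.instance Definition _ := Measure.copy (as_sigma_finite mu_sigma_finite) mu.
HB.instance Definition _ := Measure_isSigmaFinite.Build _ _ _
  (as_sigma_finite mu_sigma_finite) mu_sigma_finite.

End as_sigma_finite.

(** * Borel sets of a topological group *)

Section borel_sets.
Context (G : topologicalZmodType).

Lemma borel_open (U : set (borel G)) : open U -> measurable U.
Proof. by move=> oU; exact: sub_gen_smallest. Qed.

Lemma borel_closed (F : set (borel G)) : closed F -> measurable F.
Proof.
by move=> cF; rewrite -(setCK F); apply: measurableC; apply: borel_open; exact: closed_openC.
Qed.

Lemma borel_measurable_fun d (T : measurableType d) (f : T -> borel G) :
  (forall U, open U -> measurable (f @^-1` U)) -> measurable_fun setT f.
Proof.
move=> mf; apply: (@measurability _ _ T (borel G) setT _ (@open (borel G))) => //.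
by move=> _ [U oU <-]; rewrite setTI; exact: mf.
Qed.

Lemma borel_opp : measurable_fun setT (-%R : borel G -> borel G).
Proof.
apply: borel_measurable_fun => U oU; apply: borel_open.
by apply: open_comp => // x _; exact: opp_continuous.
Qed.

(** A countable basis makes an open set of the product a countable union of open
    rectangles. This is what makes addition measurable for the product
    sigma-field. *)
Lemma borel_prod_open (U : set (borel G * borel G)) :
  @second_countable G -> open U -> measurable U.
Proof.
move=> [B cB [Bo Bnbhs]] oU.
pose I := [set p : set (borel G) * set (borel G) | (B `*` B) p /\ p.1 `*` p.2 `<=` U].
have -> : U = \bigcup_(p in I) (p.1 `*` p.2).
  apply/seteqP; split => [[x y] Uxy|z [p [_ pU]]]; last exact: pU.
  have [[V W] /= [Vx Wy] VWU] : nbhs (x, y) U by exact: open_nbhs_nbhs.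
  have [b [Bb bx] bV] := Bnbhs x V Vx.
  have [c [Bc cy] cW] := Bnbhs y W Wy.
  by exists (b, c) => //; split => // -[s t] [/= /bV ? /cW ?]; exact: VWU.
rewrite bigcup_set_type; apply: countable_bigcupT_measurable.
  rewrite (eq_countable (card_setT _)).
  apply: sub_countable (countableX cB cB); apply: subset_card_le.
  by move=> p [].
move=> [p pI] /=; move: pI => /set_mem[[/Bo o1 /Bo o2] _].
by apply: measurableX; exact: borel_open.
Qed.

Lemma borel_add : @second_countable G ->
  measurable_fun setT (fun p : borel G * borel G => (p.1 + p.2)%R : borel G).
Proof.
move=> scG; apply: borel_measurable_fun => U oU; apply: borel_prod_open => //.
by apply: open_comp => // x _; exact: add_continuous.
Qed.

Lemma precompact_locally_finite (R : realType) (m : lfmeasure G R) (C : set (borel G)) :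
  hausdorff_space G -> measurable C -> precompact C -> m C < +oo.
Proof.
move=> hG mC [K CK [cK clK]]; apply: le_lt_trans (lfmeasure_finite m cK).
by apply: le_measure => //; apply: mem_set => //; apply: borel_closed.
Qed.

End borel_sets.

(** * Exhaustion by precompact sets with null boundary *)

Section exhaustion.
Context (R : realType) (G : topologicalZmodType) (mu : lfmeasure G R).
Hypotheses (lcG : locally_compact [set: G]) (scG : @second_countable G)
  (hG : hausdorff_space G).

(** The sets that are admissible in the definition of mass-stationarity, up to
    positivity of their measure. *)
Let continuity_set (U : set (borel G)) :=
  [/\ open U, precompact U & mu (boundary U) = 0].

Lemma measurable_boundary (U : set (borel G)) : measurable (boundary U).
Proof.
apply: measurableD; first by apply: borel_closed; exact: closed_closure.
by apply: borel_open; exact: open_interior.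
Qed.

Let continuity_set0 : continuity_set set0.
Proof.
split; [exact: open0| |by rewrite /boundary closure0 set0D measure0].
by rewrite precompactE closure0; exact: compact0.
Qed.

Let continuity_setU U V : continuity_set U -> continuity_set V ->
  continuity_set (U `|` V).
Proof.
move=> [oU pU mU] [oV pV mV]; split; first exact: openU.
  by move: pU pV; rewrite !precompactE closureU => pU pV; exact: compactU.
apply/eqP; rewrite eq_le measure_ge0 andbT.
have <- : mu (boundary U `|` boundary V) = 0.
  apply/eqP; rewrite eq_le measure_ge0 andbT -[leRHS]adde0 -{1}mU -mV.
  by apply: measureU2; exact: measurable_boundary.
apply: le_measure.
- by apply: mem_set; exact: measurable_boundary.
- by apply: mem_set; apply: measurableU; exact: measurable_boundary.
rewrite /boundary closureU => x [[cU|cV] nUV]; [left|right]; split => //.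
- by apply: contra_not nUV => ?; apply: interiorU; left.
- by apply: contra_not nUV => ?; apply: interiorU; right.
Qed.

(** The set of all (x, t) with f x = t has Lebesgue-null sections at fixed x, so
    by Fubini's theorem its section V /\ {f = t} is mu-null for almost every t. *)
Lemma null_level_set (V : set (borel G)) (f : borel G -> R) :
  measurable V -> mu V < +oo -> measurable_fun setT f ->
  exists t : R, (0 < t < 1)%R /\ mu (V `&` f @^-1` [set t]) = 0.
Proof.
move=> mV Voo mf.
pose m1 : {finite_measure set (borel G) -> \bar R} := mfrestr mV Voo.
pose leb : {sigma_finite_measure set (measurableTypeR R) -> \bar R} := @lebesgue_measure R.
pose A := [set p : borel G * measurableTypeR R | f p.1 = p.2].
have mA : measurable A.
  have -> : A = (fun p => f p.1 - p.2)%R @^-1` [set 0%R].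
    by apply/seteqP; split => p /=; [move=> ->; rewrite subrr|move/subr0_eq].
  rewrite -[X in measurable X]setTI.
  suff : measurable_fun setT (fun p : borel G * measurableTypeR R => f p.1 - p.2)%R.
    by apply.
  apply: measurable_funB; first exact: measurableT_comp mf measurable_fst.
  exact: measurable_snd.
have := indic_fubini_tonelli m1 leb mA.
have mG := indic_measurable_fun_fubini_tonelli_G m1 mA.
have -> : \int[m1]_x fubini_F leb (EFin \o \1_A) x = 0.
  apply: integral0_eq => y _; rewrite indic_fubini_tonelli_FE//=.
  rewrite (_ : xsection A y = [set f y]) ?lebesgue_measure_set1//.
  apply/seteqP; split => t; rewrite /xsection /=; first by move=> /set_mem/= ->.
  by move=> ->; apply: mem_set.
move=> /esym G0; apply: contrapT => nex.
have {G0} : \int[leb]_y `|fubini_G m1 (EFin \o \1_A) y| = 0.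
  rewrite -G0; apply: eq_integral => y _; rewrite gee0_abs//.
  exact: indic_fubini_tonelli_G_ge0.
move=> /(ae_eq_integral_abs leb measurableT mG)[N [mN N0 sN]].
have : leb `]0%R, 1%R[%classic <= leb N.
  apply: le_measure; [exact: mem_set|exact: mem_set|].
  move=> t /=; rewrite in_itv/= => t01; apply: sN => /= /(_ I) Gt0.
  apply: nex; exists t; split => //; rewrite -Gt0.
  rewrite indic_fubini_tonelli_GE//= /mfrestr /mrestr setIC; congr (mu (_ `&` V)).
  apply/seteqP; split => y; rewrite /ysection /=; first by move=> ?; exact: mem_set.
  by move=> /set_mem.
by rewrite N0 /leb/= lebesgue_measure_itv/= lte_fin ltr01 oppr0 adde0 lee_fin ler10.
Qed.

(** Take the sublevel set {f < t} of a Urysohn function f that vanishes at x and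
    equals 1 off a precompact open set. Its boundary lies in the level set
    {f = t}, which is null for a suitable t. *)
Let continuity_nbhs (x : borel G) : exists2 U, continuity_set U & U x.
Proof.
have [K nK [cK clK]] : exists2 K : set (borel G), nbhs x K & compact K /\ closed K.
  by have := @lcG x I; rewrite withinET => -[K nK [cK clK]]; exists K.
pose V : set (borel G) := interior K.
have oV : open V by exact: open_interior.
have pV : precompact V.
  by exists K => //; exact: interior_subset.
have mV := borel_open oV.
have Voo : mu V < +oo by exact: precompact_locally_finite.
have : uniform_separator [set x] (~` V).
  apply: (@locally_compact_completely_regular (borel G) R) => //.
  exact: open_closedC.
move=> /(@uniform_separatorP _ R)[f [cf f01 fx fV]].
have of_ (t : R) : open (f @^-1` [set u | u < t]%R).
  by apply: open_comp; [move=> y _; exact: cf|exact: open_lt].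
have cf_ (t : R) : closed (f @^-1` [set u | u <= t]%R).
  by apply: preimage_closed; [move=> y _; exact: cf|exact: closed_le].
have mf : measurable_fun setT f.
  apply: (measurability _ (RGenInftyO.measurableE R)) => //.
  move=> _ [_ [t ->] <-]; rewrite setTI set_itvNyo.
  by apply: borel_open; exact: of_.
have [t [/andP[t0 t1] ft]] := null_level_set mV Voo mf.
pose U := f @^-1` [set u | u < t]%R.
have UV : f @^-1` [set u | u <= t]%R `<=` V.
  move=> y /= fyt; apply: contrapT => nVy.
  have : f y = 1%R by apply: fV; exists y.
  by move=> fy; move: fyt; rewrite fy leNgt t1.
exists U; last by rewrite /U /= (_ : f x = 0%R)//; apply: fx; exists x.
split; first exact: of_.
  by apply: precompact_subset pV => y Uy; apply: UV; exact: ltW.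
apply/eqP; rewrite eq_le measure_ge0 andbT -ft.
have bU : boundary U `<=` V `&` f @^-1` [set t].
  move=> y [cUy iUy].
  have fyt : (f y <= t)%R.
    have UL : U `<=` f @^-1` [set u | u <= t]%R by move=> z; exact: ltW.
    by move: (closureS UL cUy); rewrite -(closure_id _).1.
  split; first exact: UV.
  apply/eqP; rewrite eq_le fyt /= leNgt; apply/negP => fyt'.
  by apply: iUy; apply: open_nbhs_nbhs; split => //; exact: of_.
apply: le_measure => //; apply: mem_set; first exact: measurable_boundary.
apply: measurableI => //; rewrite -[X in measurable X]setTI; exact: mf.
Qed.

(** By second countability, countably many of the neighbourhoods above cover G;
    their finite unions are still admissible. *)
Lemma continuity_set_exhaustion : exists C : (set (borel G))^nat,
  [/\ forall n, [/\ open (C n), precompact (C n) & mu (boundary (C n)) = 0],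
      nondecreasing_seq C & \bigcup_n C n = setT].
Proof.
have [B cB [Bo Bnbhs]] := scG.
have [B0|[e]] := pfcard_geP cB.
  have [b] := Bnbhs 0%R setT filterT.
  by rewrite B0 => -[].
have /choice[U HU] n : exists U, continuity_set U /\
    ((exists2 V, continuity_set V & e n `<=` V) -> e n `<=` U).
  have [[V cV eV]|nV] := pselect (exists2 V, continuity_set V & e n `<=` V).
    by exists V.
  (* A value of e that is in no admissible set contributes nothing. *)
  by exists set0; split => //.
exists (fun n => \big[setU/set0]_(i < n.+1) U i); split.
- move=> n; rewrite -/(continuity_set _); elim/big_ind : _ => // i _.
  by have [] := HU i.
- by move=> m n mn; apply/subsetPset; exact: subset_bigsetU.
- apply/seteqP; split => // x _.
  have [V cV Vx] := continuity_nbhs x.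
  have [b [Bb bx] bV] := Bnbhs x V (open_nbhs_nbhs (conj (let: And3 o _ _ := cV in o) Vx)).
  have [n _ enb] : (e @` setT) b by exact: (@surj _ _ _ _ e).
  exists n => //; rewrite big_ord_recr/=; right.
  by have [_] := HU n; apply; [exists V => //; rewrite enb|rewrite enb].
Qed.

End exhaustion.

(** * Translations of Borel sets *)

Section translations.
Context (G : topologicalZmodType).

Lemma translateK (B : set (borel G)) t : translate (translate B t) (- t)%R = B.
Proof.
by rewrite !translateE; apply/seteqP; split => x /=; rewrite opprK addrK.
Qed.

Lemma borel_shift (t : borel G) :
  measurable_fun setT (fun s : borel G => (s + t)%R : borel G).
Proof.
move=> _ B mB; rewrite setTI.
have -> : (fun s : borel G => s + t)%R @^-1` B = translate B (- t)%R.
  by rewrite translateE opprK.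
exact: measurable_translate.
Qed.

End translations.

(** * Random measures as kernels *)

Section random_measures.
Context (G : topologicalZmodType) (R : realType).
Context d (Omega : measurableType d).
Hypotheses (lcG : locally_compact [set: G]) (scG : @second_countable G)
  (hG : hausdorff_space G).

Lemma measurable_evaluation (m : Omega -> lfmeasure G R) (B : set (borel G)) :
  random_measure m -> measurable B -> measurable_fun setT (fun w => m w B).
Proof.
move=> mm mB.
have mev : measurable_fun setT (fun mu : lfmeasure G R => mu B).
  move=> _ Y mY; rewrite setTI; apply: sub_gen_smallest.
  by exists B => //; exists Y => //; rewrite setTI.
exact: (measurableT_comp mev mm).
Qed.

Lemma random_measure_xsection (m : Omega -> lfmeasure G R) :
  random_measure m -> xsection_measurable m.
Proof.
move=> mm.
have [C [HC ndC CT]] := continuity_set_exhaustion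
  (LFMeasure (@locally_finite_mzero G R)) lcG scG hG.
have mC n : measurable (C n) by apply: borel_open; have [] := HC n.
apply: (xsection_measurable_locally_finite _ mC ndC CT).
- by move=> B mB; exact: measurable_evaluation.
- by move=> n w; apply: precompact_locally_finite => //; have [] := HC n.
Qed.

End random_measures.

(** * Campbell measures and the change of variables *)

Section palm.
Context (R : realType) (G : topologicalZmodType).
Context d (Omega : measurableType d).
Variables (lambda : {measure set (borel G) -> \bar R})
  (theta : borel G -> Omega -> Omega) (xi : Omega -> lfmeasure G R)
  (nu : probability (borel G) R).
Hypotheses (lcG : locally_compact [set: G]) (scG : @second_countable G)
  (hG : hausdorff_space G) (hl : haar_measure lambda)
  (mtheta : measurable_flow theta) (mxi : random_measure xi)
  (xi_inv : flow_invariant theta xi).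

Local Notation E := (Omega * borel G)%type.

(** The Palm formula and mass-stationarity involve functions of (theta_s w, s),
    that is, compositions with [reflow]. Taking the image under [unflow] turns
    their integrals into integrals of functions of the pair (w, s) itself. *)
Definition reflow (z : E) : E := (theta z.2 z.1, z.2).
Definition unflow (z : E) : E := (theta (- z.2)%R z.1, z.2).

Lemma flowK t w : theta (- t)%R (theta t w) = w.
Proof. by rewrite (flowD mtheta) addNr (flow0 mtheta). Qed.

Lemma flowNK t w : theta t (theta (- t)%R w) = w.
Proof. by rewrite (flowD mtheta) addrN (flow0 mtheta). Qed.

Lemma reflowK : cancel reflow unflow.
Proof. by case=> w s; rewrite /unflow /reflow/= flowK. Qed.

Lemma unflowK : cancel unflow reflow.
Proof. by case=> w s; rewrite /unflow /reflow/= flowNK. Qed.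

Lemma unflow_reflow_preimage (Y : set E) : unflow @^-1` (reflow @^-1` Y) = Y.
Proof. by apply/seteqP; split => z; rewrite /= unflowK. Qed.

Lemma measurable_flow_comp d' (T : measurableType d') (f : T -> Omega) (g : T -> borel G) :
  measurable_fun setT f -> measurable_fun setT g ->
  measurable_fun setT (fun x => theta (g x) (f x)).
Proof.
move=> mf mg.
exact: (measurableT_comp (flow_measurable mtheta) (measurable_fun_pair mf mg)).
Qed.

Lemma measurable_reflow : measurable_fun setT reflow.
Proof.
apply: measurable_fun_pair; last exact: measurable_snd.
by apply: measurable_flow_comp; [exact: measurable_fst|exact: measurable_snd].
Qed.

Lemma measurable_unflow : measurable_fun setT unflow.
Proof.
apply: measurable_fun_pair; last exact: measurable_snd.
apply: measurable_flow_comp; first exact: measurable_fst.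
exact: (measurableT_comp (@borel_opp G) measurable_snd).
Qed.

Lemma xi_flow t w B : measurable B -> xi (theta t w) B = xi w (translate B t).
Proof.
move=> mB; rewrite -(xi_inv w t (measurable_translate t mB)).
by rewrite translateK.
Qed.

Lemma integral_xi_flow t w f : (forall s, 0 <= f s) -> measurable_fun setT f ->
  \int[xi (theta t w)]_s f s = \int[xi w]_s f (s - t)%R.
Proof.
move=> f0 mf.
rewrite -(ge0_integral_image_measure (borel_shift (- t)%R) (xi w) f0 mf).
apply: eq_measure_integral => A mA _.
by rewrite /image_measure/= /pushforward xi_flow// translateE.
Qed.

Let xi_kernel : xsection_measurable xi := random_measure_xsection lcG scG hG mxi.

(** Viewing lambda as a constant random measure makes the results on kernels
    available for it. *)
Let lam : lfmeasure G R := LFMeasure (haar_locally_finite hl).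

Let lam_kernel : xsection_measurable (fun _ : Omega => lam) :=
  random_measure_xsection lcG scG hG (@measurable_cst _ _ Omega (lfmeasure G R) setT lam).

(** Positivity is obtained by dropping the first sets of the exhaustion. *)
Lemma haar_exhaustion : exists C : (set (borel G))^nat,
  [/\ forall n, [/\ open (C n), precompact (C n), lambda (boundary (C n)) = 0,
                   0 < lambda (C n) & lambda (C n) < +oo],
      nondecreasing_seq C & \bigcup_n C n = setT].
Proof.
have [C [HC ndC CT]] := continuity_set_exhaustion lam lcG scG hG.
have mC n : measurable (C n) by apply: borel_open; have [] := HC n.
have [n0 Cn0] : exists n, lambda (C n) != 0.
  by apply: neq0_exhaustion => //; exact: (haar_neq0 hl).
exists (fun n => C (n0 + n)%N); split.
- move=> n; have [oC pC bC] := HC (n0 + n)%N; split=> //.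
    have n0C : 0 < lambda (C n0) by rewrite lt0e Cn0 measure_ge0.
    apply: (lt_le_trans n0C); apply: le_measure; [exact: mem_set|exact: mem_set|].
    exact/subsetPset/ndC/leq_addr.
  exact: (precompact_locally_finite lam).
- by move=> i j ij; apply: ndC; rewrite leq_add2l.
- apply/seteqP; split => // s _; have [i _ Ci] : (\bigcup_n C n) s by rewrite CT.
  by exists i => //; have /subsetPset := ndC _ _ (leq_addl n0 i); exact.
Qed.

(** The measure P(dw) xi(w, ds). *)
Definition campbell (P : {measure set Omega -> \bar R}) : {measure set E -> \bar R} :=
  semidirect P xi_kernel.

(** The only candidate for the Campbell measure of a P with Palm measure Q. *)
Definition palm_campbell (Q : {measure set Omega -> \bar R}) : {measure set E -> \bar R} :=
  image_measure measurable_unflow (semidirect Q lam_kernel).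

Lemma integral_campbell P f : (forall z, 0 <= f z) -> measurable_fun setT f ->
  \int[campbell P]_z f z = \int[P]_w \int[xi w]_s f (w, s).
Proof. by move=> f0 mf; rewrite /campbell ge0_integral_semidirect. Qed.

Lemma measurable_integral_xi (f : E -> \bar R) : (forall z, 0 <= f z) ->
  measurable_fun setT f -> measurable_fun setT (fun w => \int[xi w]_s f (w, s)).
Proof. exact: (measurable_integral_xsection xi_kernel). Qed.

Lemma integral_palm_campbell Q f : (forall z, 0 <= f z) -> measurable_fun setT f ->
  \int[palm_campbell Q]_z f z =
  \int[Q]_w \int[lambda]_s f (theta (- s)%R w, s).
Proof.
move=> f0 mf; rewrite /palm_campbell ge0_integral_image_measure//.
by rewrite ge0_integral_semidirect//; exact: measurableT_comp mf measurable_unflow.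
Qed.

(** * Mass-stationarity as invariance under resampling *)

(** The mean value of F when w is kept and the mark is replaced by a point with
    the law xi(w, . /\ C) / xi(w, C). The other branch is the image under the
    change of variables of the convention that T_C is nu where xi vanishes. *)
Definition resample (C : set (borel G)) (F : E -> \bar R) (z : E) : \bar R :=
  if xi z.1 C == 0 then \int[nu]_s F (z.1, (s + z.2)%R)
  else ((fine (xi z.1 C))^-1)%:E * \int[xi z.1]_s ((\1_C s)%:E * F (z.1, s)).

Lemma measurable_section (F : E -> \bar R) w (f : borel G -> borel G) :
  measurable_fun setT F -> measurable_fun setT f ->
  measurable_fun setT (fun s => F (w, f s)).
Proof.
move=> mF mf; apply: (measurableT_comp mF).
exact: (measurableT_comp (pair1_measurable w) mf).
Qed.

(** By invariance, xi w is the translate by - r of xi at theta_(-r) w, and this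
    translation moves C to C - r. *)
Lemma integral_T_kernel (C : set (borel G)) (mC : measurable C) F w r :
  (forall z, 0 <= F z) -> measurable_fun setT F ->
  xi (theta (- r)%R w) C < +oo ->
  \int[T_kernel xi nu mC w (- r)%R]_s F (theta (- r)%R w, (s + r)%R) =
  resample C F (unflow (w, r)).
Proof.
move=> F0 mF; rewrite /resample /unflow/= xi_flow// => Coo.
have mFr : measurable_fun setT (fun s : borel G => F (theta (- r)%R w, (s + r)%R)).
  exact: measurable_section mF (borel_shift r).
case: ifPn => [/eqP C0|C0]; first by rewrite /T_kernel integral_mnormalize_mrestr0.
have mCF : measurable_fun setT
    (fun s : borel G => (\1_C s)%:E * F (theta (- r)%R w, s)).
  apply: emeasurable_funM; first exact: measurable_EFin_indic.
  exact: measurable_section mF (@measurable_id _ _ _).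
have CF0 s : 0 <= (\1_C s)%:E * F (theta (- r)%R w, s).
  by rewrite mule_ge0// lee_fin.
rewrite /T_kernel ge0_integral_mnormalize_mrestr// integral_xi_flow//.
rewrite -ge0_integralZl//.
- apply: eq_integral => s _; rewrite opprK EFinM muleA; congr (_ * _ * _).
  by rewrite translateE !indicE /preimage opprK.
- exact: (measurableT_comp mCF (borel_shift (- - r)%R)).
Qed.

Lemma measurable_inv_mass (C : set (borel G)) : measurable C ->
  measurable_fun setT (fun w => (fine (xi w C))^-1%R).
Proof.
move=> mC; apply: (measurableT_comp (@measurable_invr R)).
apply: (measurableT_comp (@fine_measurable R setT measurableT)).
exact: measurable_evaluation.
Qed.

Lemma inv_mass_ge0 (C : set (borel G)) w : (0 <= (fine (xi w C))^-1)%R.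
Proof. by rewrite invr_ge0 fine_ge0. Qed.

Lemma resample_ge0 C F z : (forall z, 0 <= F z) -> 0 <= resample C F z.
Proof.
move=> F0; rewrite /resample; case: ifPn => _; first exact: integral_ge0.
rewrite mule_ge0 ?lee_fin ?inv_mass_ge0//.
by apply: integral_ge0 => s _; rewrite mule_ge0// lee_fin.
Qed.

Lemma measurable_resample C F : measurable C -> (forall z, 0 <= F z) ->
  measurable_fun setT F -> measurable_fun setT (resample C F).
Proof.
move=> mC F0 mF.
have mev := measurable_evaluation mxi mC.
apply: measurable_fun_ifT.
- apply: measurable_fun_eqe; last exact: measurable_cst.
  exact: measurableT_comp mev measurable_fst.
- have nuk : @xsection_measurable _ _ E (borel G) R (fun _ => nu).
    by move=> A mA; exact: measurable_fun_xsection.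
  apply: (measurable_integral_xsection
    (f := fun p : E * borel G => F (p.1.1, (p.2 + p.1.2)%R)) nuk) => //.
  apply: (measurableT_comp mF); apply: measurable_fun_pair.
    exact: measurableT_comp measurable_fst measurable_fst.
  have msum : measurable_fun setT (fun p : E * borel G => (p.2, p.1.2)).
    apply: measurable_fun_pair; first exact: measurable_snd.
    exact: measurableT_comp measurable_snd measurable_fst.
  exact: (measurableT_comp (borel_add scG) msum).
- apply: emeasurable_funM.
    apply/measurable_EFinP.
    exact: (measurableT_comp (measurable_inv_mass mC) measurable_fst).
  apply: (measurableT_comp (measurable_integral_xi
      (f := fun z : E => (\1_C z.2)%:E * F z) _ _) measurable_fst).
    by move=> z; rewrite mule_ge0// lee_fin.
  apply: emeasurable_funM => //.
  exact: (measurableT_comp (measurable_EFin_indic mC) measurable_snd).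
Qed.

Lemma integral_uniform_on (Q : {measure set Omega -> \bar R})
    (C : set (borel G)) (mC : measurable C) h :
  0 < lambda C < +oo -> (forall z, 0 <= h z) -> measurable_fun setT h ->
  \int[Q]_w \int[uniform_on lambda mC]_r h (unflow (w, r)) =
  ((fine (lambda C))^-1)%:E * \int[palm_campbell Q]_z ((\1_C z.2)%:E * h z).
Proof.
move=> /andP[C0 Coo] h0 mh.
have mCh : measurable_fun setT (fun z : E => (\1_C z.2)%:E * h z).
  apply: emeasurable_funM => //.
  exact: (measurableT_comp (measurable_EFin_indic mC) measurable_snd).
have Ch0 (z : E) : 0 <= (\1_C z.2)%:E * h z by rewrite mule_ge0// lee_fin.
have mCu : measurable_fun setT (fun z : E => (\1_C z.2)%:E * h (unflow z)).
  exact: (measurableT_comp mCh measurable_unflow).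
rewrite integral_palm_campbell// -ge0_integralZl//; last 2 first.
- exact: (measurable_integral_xsection lam_kernel (fun z => Ch0 (unflow z)) mCu).
- by move=> w _; apply: integral_ge0 => s _; exact: Ch0.
apply: eq_integral => w _.
rewrite ge0_integral_mnormalize_mrestr ?gt_eqF//; last first.
  exact: (measurableT_comp (measurableT_comp mh measurable_unflow) (pair1_measurable w)).
rewrite -ge0_integralZl//.
- by apply: eq_integral => r _; rewrite EFinM muleA.
- exact: (measurableT_comp mCu (pair1_measurable w)).
Qed.

Lemma mass_formula_left (Q : {measure set Omega -> \bar R}) (C : set (borel G))
    (mC : measurable C) (A : set E) :
  precompact C -> 0 < lambda C -> measurable A ->
  \int[Q]_w \int[uniform_on lambda mC]_r \int[T_kernel xi nu mC w (- r)%R]_s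
    (\1_A (theta s w, (s + r)%R))%:E =
  ((fine (lambda C))^-1)%:E * \int[palm_campbell Q]_z
    ((\1_C z.2)%:E * resample C (fun z => (\1_A (reflow z))%:E) z).
Proof.
move=> pC C0 mA.
have mF : measurable_fun setT (fun z : E => (\1_A (reflow z))%:E : \bar R).
  exact: (measurableT_comp (measurable_EFin_indic mA) measurable_reflow).
rewrite -(integral_uniform_on Q mC); last 3 first.
- by rewrite C0 (precompact_locally_finite lam).
- by move=> z; apply: resample_ge0 => ?; rewrite lee_fin.
- by apply: measurable_resample => // ?; rewrite lee_fin.
apply: eq_integral => w _; apply: eq_integral => r _.
rewrite -integral_T_kernel//; last exact: precompact_locally_finite.
by apply: eq_integral => s _; rewrite /reflow/= (flowD mtheta) addrK.
Qed.

Lemma mass_formula_right (Q : {measure set Omega -> \bar R}) (C : set (borel G))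
    (mC : measurable C) (A : set E) :
  precompact C -> 0 < lambda C -> measurable A ->
  (Q \x uniform_on lambda mC) A =
  ((fine (lambda C))^-1)%:E * \int[palm_campbell Q]_z
    ((\1_C z.2)%:E * (\1_A (reflow z))%:E).
Proof.
move=> pC C0 mA.
have mF : measurable_fun setT (fun z : E => (\1_A (reflow z))%:E : \bar R).
  exact: (measurableT_comp (measurable_EFin_indic mA) measurable_reflow).
rewrite -(integral_uniform_on Q mC)//; last first.
  by rewrite C0 (precompact_locally_finite lam).
rewrite /product_measure1; apply: eq_integral => w _ /=.
rewrite -[xsection A w]setIT -integral_indic//; last exact: measurable_xsection.
by apply: eq_integral => r _; rewrite unflowK !indicE mem_xsection.
Qed.

(** Both sides of the equation of mass-stationarity are integrals over w and r of
    functions of (theta_(-r) w, r). As A ranges over all measurable sets, so does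
    its preimage B under [reflow]; and the common factor 1 / lambda C cancels. *)
Lemma mass_formulaP (Q : {measure set Omega -> \bar R}) (C : set (borel G))
    (mC : measurable C) :
  precompact C -> 0 < lambda C ->
  (forall A : set E, measurable A ->
    \int[Q]_w \int[uniform_on lambda mC]_r \int[T_kernel xi nu mC w (- r)%R]_s
      (\1_A (theta s w, (s + r)%R))%:E = (Q \x uniform_on lambda mC) A) <->
  (forall B : set E, measurable B ->
    \int[palm_campbell Q]_z ((\1_C z.2)%:E * resample C (fun z => (\1_B z)%:E) z) =
    \int[palm_campbell Q]_z ((\1_C z.2)%:E * (\1_B z)%:E)).
Proof.
move=> pC C0; split => [H B mB|H A mA].
- pose A := unflow @^-1` B.
  have mA : measurable A.
    by rewrite -[A]setTI; exact: measurable_unflow.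
  have := H A mA; rewrite mass_formula_left// mass_formula_right//.
  have AB : reflow @^-1` A = B.
    by apply/seteqP; split => z; rewrite /A/= reflowK.
  rewrite -AB => /(congr1 (fun x => (fine (lambda C))%:E * x)).
  have kN0 : (fine (lambda C) != 0)%R.
    by rewrite fine_eq0 ?gt_eqF// ge0_fin_numE// (precompact_locally_finite lam).
  by rewrite !muleA -EFinM divff// !mul1e.
- rewrite mass_formula_left// mass_formula_right//; congr (_ * _).
  have := H (reflow @^-1` A); apply.
  by rewrite -[_ @^-1` _]setTI; exact: measurable_reflow.
Qed.

(** * Palm measures are mass-stationary *)

Lemma semidirect_setX (Q : {measure set Omega -> \bar R}) A (B : set (borel G)) :
  measurable A -> measurable B ->
  semidirect Q lam_kernel (A `*` B) = Q A * lambda B.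
Proof.
move=> mA mB; rewrite /semidirect muleC.
rewrite -[in Q A](setIT A) -integral_indic// -ge0_integralZl//; last exact: measurable_EFin_indic.
apply: eq_integral => w _; rewrite indicE /=.
have [wA|wA] := boolP (w \in A); first by rewrite mule1 in_xsectionX.
by rewrite mule0 notin_xsectionX// measure0.
Qed.

(** The right-hand side is the integral in the Palm formula. *)
Lemma campbell_rectangle (P : {measure set Omega -> \bar R}) A (B : set (borel G)) :
  measurable A -> measurable B ->
  image_measure measurable_reflow (campbell P) (A `*` B) =
  \int[P]_w \int[xi w]_s ((\1_A (theta s w))%:E * (\1_B s)%:E).
Proof.
move=> mA mB; rewrite -[A `*` B]setIT -integral_indic//; last exact: measurableX.
have mAB : measurable_fun setT (fun z : E => (\1_(A `*` B) z)%:E : \bar R).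
  by apply: measurable_EFin_indic; exact: measurableX.
have mABr := measurableT_comp mAB measurable_reflow.
have AB0 (z : E) : 0 <= (\1_(A `*` B) (reflow z))%:E :> \bar R by [].
rewrite (ge0_integral_image_measure measurable_reflow (campbell P) _ mAB)//.
rewrite (integral_campbell P AB0 mABr).
apply: eq_integral => w _; apply: eq_integral => s _.
by rewrite !indicE /reflow/= in_setX -mulnb natrM EFinM.
Qed.

Lemma palm_campbellE (Q : {measure set Omega -> \bar R}) (B : set E) :
  palm_campbell Q B = semidirect Q lam_kernel (unflow @^-1` B).
Proof. by []. Qed.

Section palm_disintegration.
Variables (P : {measure set Omega -> \bar R}) (Q : {sigma_finite_measure set Omega -> \bar R}).
Hypothesis PQ : is_palm lambda theta xi P Q.

Let m1 : {measure set E -> \bar R} := image_measure measurable_reflow (campbell P).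
Let m2 : {measure set E -> \bar R} := semidirect Q lam_kernel.

Let m2E A (B : set (borel G)) : measurable A -> measurable B ->
  m2 (A `*` B) = Q A * lambda B.
Proof. exact: semidirect_setX. Qed.

Let rectangle_pos A (B : set (borel G)) : measurable A -> measurable B ->
  0 < lambda B < +oo -> m1 (A `*` B) = m2 (A `*` B).
Proof.
move=> mA mB B0oo.
rewrite m2E// {1}/m1 campbell_rectangle// (PQ mB B0oo mA) /palm_formula.
move/andP: B0oo => [B0 Boo].
have Bfin : lambda B \is a fin_num by rewrite ge0_fin_numE.
rewrite -(fineK Bfin) inver fine_eq0// (gt_eqF B0).
by rewrite [RHS]muleC muleA -EFinM divff ?mul1e// fine_eq0// gt_eqF.
Qed.

(** The Palm formula does not apply to B if lambda B = 0. In that case it is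
    compared for C_0 \/ B and for C_0 minus B, which have the same positive and
    finite measure. *)
Let rectangle_fin A (B : set (borel G)) : measurable A -> measurable B ->
  Q A < +oo -> lambda B < +oo -> m1 (A `*` B) = m2 (A `*` B).
Proof.
move=> mA mB Aoo Boo.
have [B0|B0] := eqVneq (lambda B) 0; last first.
  by apply: rectangle_pos => //; rewrite Boo lt0e B0 measure_ge0.
have [C [HC _ _]] := haar_exhaustion.
have [oC pC _ C0 Coo] := HC 0%N; have mC := borel_open oC.
pose U := C 0%N `|` B; pose V := C 0%N `\` B.
have mU : measurable U by exact: measurableU.
have mV : measurable V by exact: measurableD.
have UVB : U = V `|` B by rewrite /U /V setUDl setDv setD0.
have VB0 : V `&` B = set0 by rewrite /V setDE -setIA setICl setI0.
have lV : lambda V = lambda U.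
  have : lambda (V `|` B) = lambda V + lambda B by exact: measureU.
  by rewrite UVB B0 adde0 => ->.
have lU : 0 < lambda U < +oo.
  apply/andP; split.
    by apply: (lt_le_trans C0); apply: le_measure; [exact: mem_set|exact: mem_set|exact: subsetUl].
  rewrite (@le_lt_trans _ _ (lambda (C 0%N) + lambda B))//; first exact: measureU2.
  by rewrite B0 adde0.
have : m1 (A `*` U) = m1 (A `*` V).
  by rewrite !rectangle_pos ?lV// !m2E// lV.
have AUVB : A `*` U = (A `*` V) `|` (A `*` B).
  rewrite UVB; apply/seteqP; split => [[w s] [/= Aw [Vs|Bs]]|[w s] [[]|[]] /= Aw].
  - by left.
  - by right.
  - by move=> ?; split => //; left.
  - by move=> ?; split => //; right.
rewrite AUVB measureU; [|exact: measurableX|exact: measurableX|]; last first.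
  by rewrite -setXI setIid VB0 setX0.
have Vfin : m1 (A `*` V) \is a fin_num.
  rewrite rectangle_pos ?lV// m2E// lV.
  move/andP: lU => [U0 Uoo].
  by rewrite fin_numM// ge0_fin_numE.
rewrite -[RHS]adde0 => /(congr1 (fun x => x - m1 (A `*` V))).
by rewrite m2E// B0 mule0 !(addeC (m1 (A `*` V))) !addeK.
Qed.

(** The Palm formula, which holds for all windows B at once, determines the
    measure on rectangles. *)
Lemma palm_disintegration B : measurable B -> campbell P B = palm_campbell Q B.
Proof.
move=> mB.
suff m12 X : measurable X -> m1 X = m2 X.
  rewrite palm_campbellE -[RHS]m12; last first.
    by rewrite -[_ @^-1` _]setTI; exact: measurable_unflow.
  rewrite /m1 /image_measure/= /pushforward; congr (campbell P _).
  by apply/seteqP; split => z; rewrite /= reflowK.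
have [C [HC ndC CT]] := haar_exhaustion.
have mC n : measurable (C n) by apply: borel_open; have [] := HC n.
have /sigma_finiteP[F [FT ndF HF]] := sigma_finiteT Q.
have FCT : \bigcup_n (F n `*` C n) = setT.
  apply/seteqP; split => // -[w s] _.
  have [i _ Fiw] : (\bigcup_n F n) w by rewrite -FT.
  have [j _ Cjs] : (\bigcup_n C n) s by rewrite CT.
  exists (maxn i j) => //; split => /=.
    by have /subsetPset := ndF _ _ (leq_maxl i j); exact.
  by have /subsetPset := ndC _ _ (leq_maxr i j); exact.
have mFC n : measurable (F n `*` C n).
  by apply: measurableX => //; have [] := HF n.
apply: (measure_unique [set A `*` B | A in measurable & B in measurable]
    (fun n => F n `*` C n)) => //.
- exact: measurable_prod_measurableType.
- move=> _ _ [X1 mX1 [X2 mX2 <-]] [Y1 mY1 [Y2 mY2 <-]].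
  exists (X1 `&` Y1); first exact: measurableI.
  by exists (X2 `&` Y2); [exact: measurableI|rewrite setXI].
- move=> n; exists (F n); first by have [] := HF n.
  by exists (C n).
- move=> _ [A mA [D mD <-]].
  have mAD := measurableX mA mD.
  have := @eq_measure_bigcup _ _ R m1 m2 (fun n => F n `*` C n) _ mFC _ mAD.
  rewrite FCT setIT; apply.
    move=> i j ij; apply/subsetPset => -[w s] [/= Fw Cs]; split => /=.
      by have /subsetPset := ndF _ _ ij; exact.
    by have /subsetPset := ndC _ _ ij; exact.
  move=> n; have [mF Foo] := HF n; have [_ _ _ _ Coo] := HC n.
  rewrite -setXI; apply: rectangle_fin; [exact: measurableI|exact: measurableI| |].
  + apply: le_lt_trans Foo; apply: le_measure; [|exact: mem_set|exact: subIsetr].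
    by apply: mem_set; exact: measurableI.
  + apply: le_lt_trans Coo; apply: le_measure; [|exact: mem_set|exact: subIsetr].
    by apply: mem_set; exact: measurableI.
- move=> n; have [mF Foo] := HF n; have [_ _ _ _ Coo] := HC n.
  rewrite rectangle_fin// m2E//.
  by rewrite lte_mul_pinfty// ge0_fin_numE.
Qed.

End palm_disintegration.

(** For fixed w with xi w C != 0 the resampled function does not depend on the
    mark, and integrating it over C against xi w multiplies it by xi w C, which
    cancels the normalization. If xi w C = 0, both sides vanish. *)
Lemma resample_campbell (P : {measure set Omega -> \bar R}) (C : set (borel G)) F :
  measurable C -> (forall w, xi w C < +oo) ->
  (forall z, 0 <= F z) -> measurable_fun setT F ->
  \int[campbell P]_z ((\1_C z.2)%:E * resample C F z) =
  \int[campbell P]_z ((\1_C z.2)%:E * F z).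
Proof.
move=> mC Coo F0 mF.
have mC2 : measurable_fun setT (fun z : E => (\1_C z.2)%:E : \bar R).
  exact: (measurableT_comp (measurable_EFin_indic mC) measurable_snd).
have mres := measurable_resample mC F0 mF.
have res0 z := resample_ge0 C z F0.
rewrite !integral_campbell; last 4 first.
- by move=> z; rewrite mule_ge0// lee_fin.
- exact: emeasurable_funM.
- by move=> z; rewrite mule_ge0// lee_fin.
- exact: emeasurable_funM.
apply: eq_integral => w _ /=.
have [C0|C0] := eqVneq (xi w C) 0.
  rewrite !ge0_integral_indic_null//.
  - exact: (measurable_section w mF (@measurable_id _ _ _)).
  - exact: (measurable_section w mres (@measurable_id _ _ _)).
rewrite /resample /= (negbTE C0).
pose H := \int[xi w]_s ((\1_C s)%:E * F (w, s)); rewrite -/H.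
have H0 : 0 <= H by apply: integral_ge0 => s _; rewrite mule_ge0// lee_fin.
rewrite ge0_integralZr//; last 2 first.
- exact: measurable_EFin_indic.
- by rewrite mule_ge0// lee_fin inv_mass_ge0.
rewrite integral_indic// setIT muleA.
have Cfin : xi w C \is a fin_num by rewrite ge0_fin_numE.
by rewrite -[X in X * _ * _](fineK Cfin) -EFinM divff ?mul1e// fine_eq0.
Qed.

Definition massless : set Omega := [set w | xi w setT = 0].

Lemma measurable_massless : measurable massless.
Proof.
have := measurable_evaluation mxi measurableT measurableT (emeasurable_set1 0).
by rewrite setTI.
Qed.

Lemma campbell_massless (P : {measure set Omega -> \bar R}) :
  campbell P (massless `*` setT) = 0.
Proof.
rewrite /campbell/= /semidirect; apply: integral0_eq => w _.
have [w0|w0] := boolP (w \in massless); first by rewrite in_xsectionX//; exact/set_mem.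
by rewrite notin_xsectionX// measure0.
Qed.

(** Vanishing of xi is an event that is invariant under the flow. *)
Lemma palm_campbell_massless (Q : {measure set Omega -> \bar R}) :
  palm_campbell Q (massless `*` setT) = Q massless * lambda setT.
Proof.
rewrite palm_campbellE -semidirect_setX//; last exact: measurable_massless.
congr (semidirect _ _ _); apply/seteqP.
by split => -[w s]; rewrite /massless /unflow/= xi_flow// => -[];
  rewrite translateE preimage_setT.
Qed.

Lemma palm_mass_stationary (P : {measure set Omega -> \bar R})
    (Q : {sigma_finite_measure set Omega -> \bar R}) :
  is_palm lambda theta xi P Q -> mass_stationary lambda theta xi nu Q.
Proof.
move=> PQ; have PQE := palm_disintegration PQ.
split=> [|C mC pC C0 bC].
  have := palm_campbell_massless Q; rewrite -PQE ?campbell_massless; last first.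
    by apply: measurableX => //; exact: measurable_massless.
  move=> /esym/eqP; rewrite mule_eq0 (negbTE (haar_neq0 hl)) orbF => /eqP.
  exact.
apply/(mass_formulaP Q mC pC C0) => B mB.
have eqI (f : E -> \bar R) : \int[palm_campbell Q]_z f z = \int[campbell P]_z f z.
  by apply: eq_measure_integral => A mA _; exact/esym/PQE.
rewrite !eqI; apply: resample_campbell => //.
- by move=> w; exact: precompact_locally_finite.
- exact: measurable_EFin_indic.
Qed.

(** * Inversion of the Campbell measure *)

Definition charged (C : set (borel G)) : set Omega := [set w | xi w C != 0].

Lemma measurable_charged C : measurable C -> measurable (charged C).
Proof.
move=> mC.
have := measurable_evaluation mxi mC measurableT (measurableC (emeasurable_set1 0)).
rewrite setTI; congr measurable.
by apply/seteqP; split => w /=; [move/eqP|move=> /eqP].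
Qed.

(** The inverse is taken in the reals, so that the density is 0 where C has no
    mass. *)
Definition inversion_density (C : set (borel G)) (z : E) : R :=
  (\1_C z.2 * (fine (xi z.1 C))^-1)%R.

Lemma inversion_density_ge0 C z : (0 <= inversion_density C z)%R.
Proof. by rewrite mulr_ge0// inv_mass_ge0. Qed.

Lemma measurable_inversion_density C : measurable C ->
  measurable_fun setT (inversion_density C).
Proof.
move=> mC; apply: measurable_funM.
  exact: (measurableT_comp (measurable_indic mC) measurable_snd).
exact: (measurableT_comp (measurable_inv_mass mC) measurable_fst).
Qed.

(** For w in A, the integral of the density over the mark against xi w is
    xi w C / xi w C = 1. *)
Lemma campbell_inversion (P : {measure set Omega -> \bar R}) (C : set (borel G)) A :
  measurable C -> (forall w, xi w C < +oo) -> measurable A -> A `<=` charged C ->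
  P A = \int[campbell P]_z ((inversion_density C z)%:E * (\1_A z.1)%:E).
Proof.
move=> mC Coo mA AC.
have mA1 : measurable_fun setT (fun z : E => (\1_A z.1)%:E : \bar R).
  exact: (measurableT_comp (measurable_EFin_indic mA) measurable_fst).
have mf : measurable_fun setT
    (fun z : E => (inversion_density C z)%:E * (\1_A z.1)%:E : \bar R).
  apply: emeasurable_funM => //; apply/measurable_EFinP.
  exact: measurable_inversion_density.
rewrite integral_campbell//; last first.
  by move=> z; apply: mule_ge0; rewrite lee_fin// inversion_density_ge0.
rewrite -[in LHS](setIT A) -integral_indic//; apply: eq_integral => w _ /=.
have [wA|wA] := boolP (w \in A); last first.
  rewrite indicE (negbTE wA) integral0_eq// => s _.
  by rewrite mule0.
under eq_integral do rewrite /inversion_density /= (mulrC (\1_C _)) [\1_A w]indicE wA mule1 EFinM.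
have C0 : xi w C != 0 by apply: AC; exact/set_mem.
rewrite ge0_integralZl//; last exact: measurable_EFin_indic.
rewrite integral_indic// setIT [\1_A w]indicE wA.
have Cfin : xi w C \is a fin_num by rewrite ge0_fin_numE.
by rewrite -[X in _ * X](fineK Cfin) -EFinM mulVf// fine_eq0.
Qed.

Section exhausted.
Variable C : (set (borel G))^nat.
Hypotheses (mC : forall n, measurable (C n)) (Coo : forall n w, xi w (C n) < +oo)
  (ndC : nondecreasing_seq C) (CT : \bigcup_n C n = setT).

Lemma charged_nondecreasing : nondecreasing_seq (fun n => charged (C n)).
Proof.
move=> i j ij; apply/subsetPset => w; rewrite /charged/= => Ci.
rewrite -measure_gt0; move: Ci; rewrite -measure_gt0 => /lt_le_trans; apply.
by apply: le_measure; [exact: mem_set|exact: mem_set|exact/subsetPset/ndC].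
Qed.

Lemma charged_bigcup : \bigcup_n charged (C n) = ~` massless.
Proof.
apply/seteqP; split => [w [n _ /eqP Cn] w0|w w0].
  by apply: Cn; apply: (subset_measure0 _ _ _ w0).
have [n Cn] : exists n, xi w (C n) != 0.
  by apply: neq0_exhaustion => //; exact/eqP.
by exists n.
Qed.

(** P1 and P2 are recovered by the same formula on each event xi (C n) != 0, and
    these events exhaust the complement of the massless one. *)
Lemma campbell_inj (P1 P2 : {measure set Omega -> \bar R}) :
  (forall B, measurable B -> campbell P1 B = campbell P2 B) ->
  P1 massless = 0 -> P2 massless = 0 ->
  forall A, measurable A -> P1 A = P2 A.
Proof.
move=> P12 P1m P2m A mA.
have mch n := measurable_charged (mC n).
apply: (@eq_measure_conull _ _ _ P1 P2 (~` massless)); rewrite ?setCK//.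
  by apply: measurableC; exact: measurable_massless.
rewrite -charged_bigcup; apply: eq_measure_bigcup => //; first exact: charged_nondecreasing.
move=> n.
have mAn : measurable (A `&` charged (C n)) by exact: measurableI.
rewrite (campbell_inversion P1 (mC n) (Coo n) mAn); last exact: subIsetr.
rewrite (campbell_inversion P2 (mC n) (Coo n) mAn); last exact: subIsetr.
by apply: eq_measure_integral => B mB _; exact: P12.
Qed.

Section gluing.
Variable Q : {sigma_finite_measure set Omega -> \bar R}.
Let Lam : {measure set E -> \bar R} := palm_campbell Q.
Hypothesis Q0 : Q massless = 0.
Hypothesis resampleP : forall n B, measurable B ->
  \int[Lam]_z ((\1_(C n) z.2)%:E * resample (C n) (fun z => (\1_B z)%:E) z) =
  \int[Lam]_z ((\1_(C n) z.2)%:E * (\1_B z)%:E).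

Let D n : set E := charged (C n) `*` C n.

Let mD n : measurable (D n).
Proof. by apply: measurableX => //; exact: measurable_charged. Qed.

(** By [campbell_inversion], any P whose Campbell measure is Lam must coincide with
    this measure on the event xi (C n) != 0. *)
Definition local_inverse n : {measure set Omega -> \bar R} :=
  image_measure measurable_fst
    (density Lam (inversion_density_ge0 (C n)) (measurable_inversion_density (mC n))).

Lemma integral_local_inverse n h : (forall w, 0 <= h w) -> measurable_fun setT h ->
  \int[local_inverse n]_w h w =
  \int[Lam]_z ((inversion_density (C n) z)%:E * h z.1).
Proof.
move=> h0 mh; rewrite /local_inverse ge0_integral_image_measure//.
rewrite (ge0_integral_density Lam)//.
exact: measurableT_comp mh measurable_fst.
Qed.

(** Invariance under resampling is used for the intersection of B with D n.
    Resampling does not move w, so the convention for xi w (C n) = 0 never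
    interferes. *)
Let campbell_local_indic n B : measurable B ->
  \int[campbell (local_inverse n)]_z ((\1_(C n) z.2)%:E * (\1_B z)%:E) =
  \int[Lam]_z ((\1_(D n) z)%:E * (\1_B z)%:E).
Proof.
move=> mB.
pose BD := B `&` D n.
have mBD : measurable BD by exact: measurableI.
have mC2 : measurable_fun setT (fun z : E => (\1_(C n) z.2)%:E : \bar R).
  exact: (measurableT_comp (measurable_EFin_indic (mC n)) measurable_snd).
have mCB : measurable_fun setT (fun z : E => (\1_(C n) z.2)%:E * (\1_B z)%:E : \bar R).
  by apply: emeasurable_funM => //; exact: measurable_EFin_indic.
have CB0 (z : E) : 0 <= (\1_(C n) z.2)%:E * (\1_B z)%:E :> \bar R.
  by apply: mule_ge0; rewrite lee_fin.
have -> : \int[Lam]_z ((\1_(D n) z)%:E * (\1_B z)%:E) =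
    \int[Lam]_z ((\1_(C n) z.2)%:E * (\1_BD z)%:E).
  apply: eq_integral => -[w s] _; rewrite -!EFinM /BD /D !indicE in_setI !in_setX /=.
  by case: (_ \in B); case: (w \in _); case: (s \in _); rewrite ?(mulr0, mul0r, mulr1).
rewrite -resampleP// integral_campbell// integral_local_inverse; last 2 first.
- by move=> w; exact: integral_ge0.
- exact: (measurable_integral_xi CB0 mCB).
apply: eq_integral => -[w r] _ /=.
rewrite /resample /inversion_density /=.
have [w0|w0] := eqVneq (xi w (C n)) 0.
  rewrite w0 /= invr0 mulr0 mul0e [X in _ * X]integral0_eq ?mule0// => s _.
  rewrite indicE memNset//= => -[_ [/=]].
  by rewrite /charged/= w0 eqxx.
rewrite EFinM -muleA; congr (_ * (_ * _)).
apply: eq_integral => s _; rewrite -!EFinM /BD /D !indicE in_setI !in_setX /=.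
have -> : w \in charged (C n) by exact: mem_set.
by case: (_ \in B); case: (s \in _); rewrite ?(mulr0, mul0r, mulr1).
Qed.

Lemma campbell_local n F : (forall z, 0 <= F z) -> measurable_fun setT F ->
  \int[campbell (local_inverse n)]_z ((\1_(C n) z.2)%:E * F z) =
  \int[Lam]_z ((\1_(D n) z)%:E * F z).
Proof.
move=> F0 mF.
have g1 (z : E) : (0 <= \1_(C n) z.2 :> R)%R by [].
have g2 (z : E) : (0 <= \1_(D n) z :> R)%R by [].
have mg1 : measurable_fun setT (fun z : E => \1_(C n) z.2 : R).
  exact: (measurableT_comp (measurable_indic (mC n)) measurable_snd).
have mg2 : measurable_fun setT (fun z : E => \1_(D n) z : R).
  exact: measurable_indic.
transitivity (\int[density (campbell (local_inverse n)) g1 mg1]_z F z).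
  by rewrite ge0_integral_density.
transitivity (\int[density Lam g2 mg2]_z F z); last by rewrite ge0_integral_density.
apply: eq_measure_integral => B mB _.
have densE (m : {measure set E -> \bar R}) : m B = \int[m]_z (\1_B z)%:E.
  by rewrite integral_indic// setIT.
rewrite !densE (ge0_integral_density _ g1 mg1)//; last exact: measurable_EFin_indic.
rewrite (ge0_integral_density _ g2 mg2)//; last exact: measurable_EFin_indic.
exact: campbell_local_indic.
Qed.

(** On D m, which contains all (w, s) with w in A and s in C n, the Campbell
    measure of the m-th local inverse is Lam. So the inversion formula for C n
    can be applied to it. *)
Lemma local_inverse_consistent n m A : (n <= m)%N -> measurable A ->
  A `<=` charged (C n) -> local_inverse n A = local_inverse m A.
Proof.
move=> nm mA AC.
have mA1 : measurable_fun setT (fun z : E => (\1_A z.1)%:E : \bar R).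
  exact: (measurableT_comp (measurable_EFin_indic mA) measurable_fst).
have mf : measurable_fun setT
    (fun z : E => (inversion_density (C n) z)%:E * (\1_A z.1)%:E : \bar R).
  apply: emeasurable_funM => //; apply/measurable_EFinP.
  exact: measurable_inversion_density.
have f0 (z : E) : 0 <= (inversion_density (C n) z)%:E * (\1_A z.1)%:E.
  by apply: mule_ge0; rewrite lee_fin// inversion_density_ge0.
rewrite (campbell_inversion (local_inverse m) (mC n) (Coo n) mA AC).
rewrite -[A]setIT -integral_indic// setIT integral_local_inverse//; last first.
  exact: measurable_EFin_indic.
have CnCm : C n `<=` C m by exact/subsetPset/ndC.
transitivity (\int[Lam]_z ((\1_(D m) z)%:E *
    ((inversion_density (C n) z)%:E * (\1_A z.1)%:E))).
  apply: eq_integral => -[w s] _ /=.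
  have [wA|wA] := boolP (w \in A); last by rewrite indicE (negbTE wA) !mule0.
  have [sC|sC] := boolP (s \in C n); last first.
    by rewrite /inversion_density/= [\1_(C n) s]indicE (negbTE sC) !mul0r mul0e mule0.
  rewrite [\1_(D m) _]indicE in_setX/= (mem_set (CnCm _ (set_mem sC))) andbT.
  have /subsetPset/(_ w (AC _ (set_mem wA))) wm := charged_nondecreasing nm.
  by rewrite (mem_set wm) mul1e.
rewrite -campbell_local//; apply: eq_integral => -[w s] _ /=.
have [sC|sC] := boolP (s \in C n).
  by rewrite [\1_(C m) _]indicE (mem_set (CnCm _ (set_mem sC))) mul1e.
by rewrite /inversion_density/= [\1_(C n) s]indicE (negbTE sC) !mul0r mul0e mule0.
Qed.

(** The event that n is the first index with xi (C n) != 0. *)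
Let En n := seqDU (fun n => charged (C n)) n.

Let mEn n : measurable (En n).
Proof.
apply: measurableD; first exact: measurable_charged.
by apply: bigsetU_measurable => i _; exact: measurable_charged.
Qed.

Let EnC n : En n `<=` charged (C n).
Proof. by move=> w []. Qed.

Definition glued_inverse : {measure set Omega -> \bar R} :=
  mseries (fun n => mrestr (local_inverse n) (mEn n)) 0.

Lemma glued_inverse_massless : glued_inverse massless = 0.
Proof.
apply: eseries0 => n _ _.
transitivity (local_inverse n (massless `&` En n)) => //.
rewrite (_ : _ `&` _ = set0) ?measure0//.
apply/seteqP; split => // w [w0 /EnC wn].
by have : (~` massless) w by rewrite -charged_bigcup; exists n.
Qed.

(** If n > m, the event En n is disjoint from A; otherwise consistency replaces
    the n-th local inverse by the m-th one. *)
Lemma glued_inverseE m A : measurable A -> A `<=` charged (C m) ->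
  glued_inverse A = local_inverse m A.
Proof.
move=> mA AC.
have -> : local_inverse m A = \sum_(n <oo) local_inverse m (A `&` En n).
  rewrite -measure_semi_bigcup; last 3 first.
  - by move=> n; exact: measurableI.
  - by apply: trivIset_setIl; exact: trivIset_seqDU.
  - by apply: bigcup_measurable => n _; exact: measurableI.
  rewrite -setI_bigcupr -seqDU_bigcup_eq; congr (local_inverse m _).
  by apply/esym/setIidPl => w Aw; exists m => //; exact: AC.
apply: eq_eseriesr => n _.
transitivity (local_inverse n (A `&` En n)) => //.
have [nm|mn] := leqP n m.
  apply: local_inverse_consistent => //; first exact: measurableI.
  by move=> w [_ /EnC].
rewrite (_ : A `&` _ = set0) ?measure0//.
apply/seteqP; split => // w [/AC wm] [_]; apply.
by rewrite -(bigcup_mkord n (fun k => charged (C k))); exists m.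
Qed.

Let D_nd : nondecreasing_seq D.
Proof.
move=> i j ij; apply/subsetPset => -[w s] [/= wi si]; split => /=.
  by move/subsetPset : (charged_nondecreasing ij); exact.
by move/subsetPset : (ndC ij); exact.
Qed.

Let D_bigcup : \bigcup_n D n = ~` (massless `*` setT).
Proof.
apply/seteqP; split => [[w s] [n _ [/= wn sn]] [/= w0 _]|[w s] ws].
  by have : (~` massless) w by rewrite -charged_bigcup; exists n.
have : (~` massless) w by move=> w0; exact: ws.
rewrite -charged_bigcup => -[i _ wi].
have [j _ sj] : (\bigcup_n C n) s by rewrite CT.
exists (maxn i j) => //; split => /=.
  by have /subsetPset := charged_nondecreasing (leq_maxl i j); exact.
by have /subsetPset := ndC (leq_maxr i j); exact.
Qed.

Let campbell_charged (P : {measure set Omega -> \bar R}) m X : X `<=` D m ->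
  campbell P X = \int[P]_(w in charged (C m)) xi w (xsection X w).
Proof.
move=> XD; rewrite [RHS]integral_mkcond; apply: eq_integral => w _.
rewrite patchE; case: ifPn => // wm.
rewrite (_ : xsection X w = set0) ?measure0//.
apply/seteqP; split => // s /xsectionP/XD[/= ws _].
by move: wm; rewrite notin_setE.
Qed.

(** On D m the glued measure may be replaced by the m-th local inverse. The sets
    D m exhaust the complement of the massless event, which is null for both
    sides. *)
Lemma campbell_glued_inverse B : measurable B ->
  campbell glued_inverse B = Lam B.
Proof.
move=> mB.
have mX : measurable (massless `*` [set: borel G]).
  by apply: measurableX => //; exact: measurable_massless.
apply: (@eq_measure_conull _ _ _ _ _ (~` (massless `*` setT))) => //.
- exact: measurableC.
- by rewrite setCK campbell_massless.
- rewrite setCK; transitivity (Q massless * lambda setT).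
    exact: palm_campbell_massless.
  by rewrite Q0 mul0e.
rewrite -D_bigcup; apply: eq_measure_bigcup => // m.
have XD : B `&` D m `<=` D m by exact: subIsetr.
have mBD : measurable (B `&` D m) by exact: measurableI.
rewrite (campbell_charged _ XD).
rewrite (@eq_measure_integral _ _ _ _ (local_inverse m)); last first.
  by move=> A mA AC; exact: glued_inverseE.
rewrite -campbell_charged// -[LHS]mul1e.
have indE (mu : {measure set E -> \bar R}) : mu (B `&` D m) =
    \int[mu]_z ((\1_(D m) z)%:E * (\1_(B `&` D m) z)%:E).
  rewrite -[in LHS](setIT (B `&` D m)) -integral_indic//.
  apply: eq_integral => z _; rewrite -EFinM !indicE in_setI.
  by case: (_ \in B); case: (_ \in _); rewrite ?(mulr0, mul0r, mulr1).
rewrite mul1e indE [RHS]indE -campbell_local//; last exact: measurable_EFin_indic.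
apply: eq_integral => -[w s] _; rewrite -!EFinM /D !indicE in_setI !in_setX/=.
by case: (_ \in B); case: (w \in _); case: (s \in _); rewrite ?(mulr0, mul0r, mulr1).
Qed.

End gluing.

(** Lam is finite on sets S n that increase to the whole space. As the
    mass that xi w gives to the section of S n at w has P-integral Lam (S n),
    Markov's inequality makes P finite on the event that this mass is at least
    1 / (n + 1). *)
Lemma palm_sigma_finite (P : {measure set Omega -> \bar R})
    (Q : {sigma_finite_measure set Omega -> \bar R}) :
  (forall n, lambda (C n) < +oo) -> P massless = 0 ->
  (forall B, measurable B -> campbell P B = palm_campbell Q B) ->
  sigma_finite setT P.
Proof.
move=> lC P0 PQE.
have /sigma_finiteP[F [FT ndF HF]] := sigma_finiteT Q.
pose S n : set E := reflow @^-1` (F n `*` C n).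
have mS n : measurable (S n).
  rewrite -[S n]setTI; apply: measurable_reflow => //.
  by apply: measurableX => //; have [] := HF n.
have PS n : \int[P]_w xi w (xsection (S n) w) < +oo.
  rewrite -[ltLHS]/(campbell P (S n)) PQE// palm_campbellE.
  rewrite unflow_reflow_preimage.
  have [mF Foo] := HF n; rewrite semidirect_setX//.
  by rewrite lte_mul_pinfty// ge0_fin_numE.
pose W n := [set w | (n.+1%:R^-1)%:E <= xi w (xsection (S n) w)].
have mW n : measurable (W n).
  rewrite -[W n]setTI; apply: emeasurable_fun_c_infty => //.
  exact: xi_kernel.
exists (fun n => massless `|` W n).
  apply/esym/seteqP; split => // w _.
  have [w0|w0] := pselect (massless w); first by exists 0%N => //; left.
  have ndS i j : (i <= j)%N -> xsection (S i) w `<=` xsection (S j) w.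
    move=> ij s /xsectionP[/= Fs Cs]; apply/xsectionP; split => /=.
      by move/subsetPset : (ndF _ _ ij); exact.
    by move/subsetPset : (ndC ij); exact.
  have ST : \bigcup_n xsection (S n) w = setT.
    apply/seteqP; split => // s _.
    have [i _ Fi] : (\bigcup_n F n) (theta s w) by rewrite -FT.
    have [j _ Cj] : (\bigcup_n C n) s by rewrite CT.
    exists (maxn i j) => //; apply/xsectionP; split => /=.
      by have /subsetPset := ndF _ _ (leq_maxl i j); exact.
    by have /subsetPset := ndC (leq_maxr i j); exact.
  have [n n0] : exists n, xi w (xsection (S n) w) != 0.
    apply: neq0_exhaustion => //; last exact/eqP.
    + by move=> n; exact: measurable_xsection.
    + by move=> i j ij; apply/subsetPset; exact: ndS.
  have [k kn] : exists k : nat, (k.+1%:R^-1)%:E <= xi w (xsection (S n) w).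
    have : 0 < xi w (xsection (S n) w) by rewrite lt0e n0 measure_ge0.
    case: (xi w (xsection (S n) w)) => [r| |].
    + rewrite lte_fin => r0; exists (Num.truncn r^-1); rewrite lee_fin.
      rewrite -[leRHS]invrK lef_pV2 ?posrE ?invr_gt0// ltW//.
      by rewrite truncnS_gt// invr_ge0 ltW.
    + by exists 0%N; rewrite leey.
    + by rewrite ltNge leNye.
  exists (maxn n k) => //; right; rewrite /W /=.
  apply: (@le_trans _ _ (k.+1%:R^-1)%:E).
    by rewrite lee_fin lef_pV2 ?posrE// ler_nat ltnS leq_maxr.
  apply: (le_trans kn); apply: le_measure; [apply: mem_set; exact: measurable_xsection..|].
  exact/ndS/leq_maxl.
move=> n; split; first by apply: measurableU => //; exact: measurable_massless.
apply: (@le_lt_trans _ _ (P (W n))).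
  apply: (@le_trans _ _ (P massless + P (W n))).
    by apply: measureU2 => //; exact: measurable_massless.
  by rewrite P0 add0e.
have Markov : (n.+1%:R^-1)%:E * P (W n) <= \int[P]_w xi w (xsection (S n) w).
  rewrite -[W n]setIT -integral_indic// -ge0_integralZl//; last exact: measurable_EFin_indic.
  apply: ge0_le_integral => //.
  - by apply: measurable_funeM; exact: measurable_EFin_indic.
  - exact: xi_kernel.
  move=> w _; rewrite indicE; have [|_] := boolP (w \in W n); last by rewrite mule0.
  by move=> /set_mem wW; rewrite mule1.
have : (n.+1%:R^-1)%:E * P (W n) < +oo by exact: le_lt_trans (PS n).
case: (P (W n)) => [r _||]; rewrite ?ltry//.
by rewrite gt0_muley// lte_fin invr_gt0.
Qed.

End exhausted.

(** * Stationarity and the Palm property of the inverse *)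

Lemma measurable_flow_at t : measurable_fun setT (theta t).
Proof. by apply: measurable_flow_comp; [exact: measurable_id|exact: measurable_cst]. Qed.

Let shift t (z : E) : E := (theta t z.1, (z.2 - t)%R).

Let measurable_shift t : measurable_fun setT (shift t).
Proof.
apply: measurable_fun_pair.
  exact: (measurableT_comp (measurable_flow_at t) measurable_fst).
exact: (measurableT_comp (borel_shift (- t)%R) measurable_snd).
Qed.

(** This is invariance of xi. *)
Lemma campbell_flow (P : {measure set Omega -> \bar R}) t B : measurable B ->
  campbell (image_measure (measurable_flow_at t) P) B = campbell P (shift t @^-1` B).
Proof.
move=> mB; rewrite /campbell /= /semidirect.
rewrite ge0_integral_image_measure//; last exact: xi_kernel.
apply: eq_integral => w _; rewrite xi_flow; last exact: measurable_xsection.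
by rewrite translateE.
Qed.

(** The map [unflow] turns the translation of the mark by - t into the map
    (w, s) |-> (theta_t w, s - t), so this is invariance of lambda. *)
Lemma palm_campbell_flow (Q : {measure set Omega -> \bar R}) t B : measurable B ->
  palm_campbell Q (shift t @^-1` B) = palm_campbell Q B.
Proof.
move=> mB; rewrite !palm_campbellE /= /semidirect; apply: eq_integral => w _.
have muB : measurable (unflow @^-1` B).
  by rewrite -[_ @^-1` _]setTI; exact: measurable_unflow.
rewrite -[RHS](haar_invariant hl t); last exact: measurable_xsection.
rewrite translateE; congr (lambda _); apply/seteqP.
by split => s /=; rewrite /xsection/= => /set_mem; rewrite /unflow /shift/= => H;
  apply: mem_set; move: H; rewrite /unflow/= (flowD mtheta) opprB.
Qed.

Lemma disintegration_is_palm (P Q : {measure set Omega -> \bar R}) :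
  (forall B, measurable B -> campbell P B = palm_campbell Q B) ->
  is_palm lambda theta xi P Q.
Proof.
move=> PQE B mB /andP[B0 Boo] A mA; rewrite /palm_formula -campbell_rectangle//.
rewrite -[X in _ = _ * X]/(campbell P (reflow @^-1` (A `*` B))) PQE; last first.
  by rewrite -[_ @^-1` _]setTI; apply: measurable_reflow => //; exact: measurableX.
rewrite palm_campbellE unflow_reflow_preimage semidirect_setX//.
have Bfin : lambda B \is a fin_num by rewrite ge0_fin_numE.
have BN0 : (fine (lambda B) != 0)%R by rewrite fine_eq0// gt_eqF.
rewrite -(fineK Bfin) inver (negbTE BN0) [X in _ * X]muleC muleA -EFinM.
by rewrite mulVf// mul1e.
Qed.

Lemma mass_stationary_palm (Q : {sigma_finite_measure set Omega -> \bar R}) :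
  mass_stationary lambda theta xi nu Q ->
  exists P : {sigma_finite_measure set Omega -> \bar R},
    stationary theta P /\ is_palm lambda theta xi P Q.
Proof.
move=> [Q0 HQ].
have [C [HC ndC CT]] := haar_exhaustion.
have mC n : measurable (C n) by apply: borel_open; have [] := HC n.
have pC n : precompact (C n) by have [] := HC n.
have Coo n w : xi w (C n) < +oo by exact: precompact_locally_finite.
have lC n : lambda (C n) < +oo by have [] := HC n.
have lC0 n : 0 < lambda (C n) by have [] := HC n.
have resampleP n B : measurable B ->
    \int[palm_campbell Q]_z
      ((\1_(C n) z.2)%:E * resample (C n) (fun z => (\1_B z)%:E) z) =
    \int[palm_campbell Q]_z ((\1_(C n) z.2)%:E * (\1_B z)%:E).
  apply: (mass_formulaP Q (mC n) (pC n) (lC0 n)).1.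
  by apply: HQ => //; have [] := HC n.
have [P [PE P0]] : exists P : {measure set Omega -> \bar R},
    (forall B, measurable B -> campbell P B = palm_campbell Q B) /\ P massless = 0.
  exists (glued_inverse mC Q); split; last exact: glued_inverse_massless.
  by move=> B mB; exact: campbell_glued_inverse.
have sfP : sigma_finite setT P.
  exact: (palm_sigma_finite mC ndC CT lC P0 PE).
exists (as_sigma_finite sfP); split; last exact: disintegration_is_palm.
move=> t A mA.
apply: (campbell_inj mC Coo ndC CT (P1 := image_measure (measurable_flow_at t) P)
  (P2 := P)) => //.
- move=> B mB; rewrite campbell_flow// !PE//; first exact: palm_campbell_flow.
  by rewrite -[_ @^-1` _]setTI; exact: measurable_shift.
- rewrite -[RHS]P0 /image_measure/= /pushforward; congr (P _).
  by apply/seteqP; split => w; rewrite /massless/= xi_flow// translateE preimage_setT.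
Qed.

End palm.

(** * The characterization *)

Theorem theorem6p3 (R : realType) (G : topologicalZmodType)
  (d : measure_display) (Omega : measurableType d)
  (lambda : {measure set (borel G) -> \bar R})
  (theta : borel G -> Omega -> Omega)
  (xi : Omega -> lfmeasure G R) (nu : probability (borel G) R)
  (Q : {sigma_finite_measure set Omega -> \bar R}) :
  locally_compact [set: G] -> @second_countable G -> hausdorff_space G ->
  haar_measure lambda -> measurable_flow theta ->
  random_measure xi -> flow_invariant theta xi ->
  (exists P : {sigma_finite_measure set Omega -> \bar R},
     stationary theta P /\ is_palm lambda theta xi P Q)
  <-> mass_stationary lambda theta xi nu Q.
Proof.
move=> lcG scG hG hl mtheta mxi xi_inv; split => [[P [_ PQ]]|].
  exact: (palm_mass_stationary nu lcG scG hG hl mtheta mxi xi_inv PQ).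
exact: mass_stationary_palm.
Qed.
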